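(* The Skolem problem is PSPACE-hard for polyrec sequences over $\mathbb{Q}$.
   Context: A sequence $u^{(1)}=\langle u^{(1)}_n\rangle_{n\in\mathbb{N}}$ over a field $\mathbb{F}$ is polynomially recursive (polyrec) of dimension $k$ if there are auxiliary sequences $u^{(2)},\ldots,u^{(k)}$ over $\mathbb{F}$ and polynomials $P_1,\ldots,P_k\in\mathbb{F}[x_1,\ldots,x_k]$ such that $u^{(i)}_{n+1}=P_i(u^{(1)}_n,\ldots,u^{(k)}_n)$ for all $i\in\{1,\ldots,k\}$ and all $n\in\mathbb{N}$. Such a sequence is given on input by the initial values $u^{(1)}_0,\ldots,u^{(k)}_0\in\mathbb{F}$ together with arithmetic circuits representing $P_1,\ldots,P_k$. An arithmetic circuit uses binary addition and multiplication gates, nullary input gates bijectively labelled with the variables, and nullary constant gates each labelled with an element of $\mathbb{F}$, and has designated output gates. The Skolem problem: given a polyrec sequence $u=u^{(1)}$ in this encoding, decide whether there exists $n\in\mathbb{N}$ with $u_n=0$. *)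

(* Defs.v *)
From HB Require Import structures.
From mathcomp Require Import all_boot all_order all_algebra.
From mathcomp Require Import mpoly.

Set Implicit Arguments.
Unset Strict Implicit.
Unset Printing Implicit Defensive.

Import GRing.Theory.
Local Open Scope ring_scope.

(** * Deterministic multi-tape Turing machines *)

Inductive move := MoveL | Stay | MoveR.

(* The words over {0,1} are written on the tapes through [bit]. *)
Record machine := Machine {
  symbol : finType;
  state : finType;
  tapes : nat; (* the machine has tapes.+1 >= 1 tapes *)
  blank : symbol;
  bit : bool -> symbol;
  bit_inj : injective bit;
  bit_neq_blank : forall b, bit b != blank;
  start : state;
  halting : pred state;
  accepting : pred state;
  delta : state -> {ffun 'I_tapes.+1 -> symbol} ->
          state * {ffun 'I_tapes.+1 -> symbol * move} }.

(* A two-way infinite tape.  [tleft] lists the cells strictly to the left of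
   the head, nearest first; [tright] lists the cells from the scanned one
   rightwards.  All the cells that are not listed are blank. *)
Record tape (G : Type) := Tape { tleft : seq G; tright : seq G }.

Definition tape_read (G : Type) (b : G) (t : tape G) : G := head b (tright t).

Definition tape_write (G : Type) (a : G) (t : tape G) : tape G :=
  Tape (tleft t) (a :: behead (tright t)).

Definition tape_move (G : Type) (b : G) (m : move) (t : tape G) : tape G :=
  match m with
  | MoveL => Tape (behead (tleft t)) (head b (tleft t) :: tright t)
  | Stay => t
  | MoveR => Tape (head b (tright t) :: tleft t) (behead (tright t))
  end.

(* Listed cells are never dropped, and every visited cell gets listed. *)
Definition tape_cells (G : Type) (t : tape G) : nat :=
  (size (tleft t) + size (tright t))%N.

Record config (M : machine) := Config {
  cstate : state M;
  ctape : {ffun 'I_(tapes M).+1 -> tape (symbol M)} }.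

Definition step (M : machine) (c : config M) : config M :=
  if halting (cstate c) then c else
  let r := delta (cstate c) [ffun i => tape_read (blank M) (ctape c i)] in
  Config r.1
    [ffun i => tape_move (blank M) (r.2 i).2 (tape_write (r.2 i).1 (ctape c i))].

(* The input is on the first tape, with the head on its first letter. *)
Definition initial (M : machine) (w : seq bool) : config M :=
  Config (start M)
    [ffun i => if i == ord0 then Tape [::] (map (@bit M) w) else Tape [::] [::]].

Definition run (M : machine) (w : seq bool) (t : nat) : config M :=
  iter t (@step M) (initial M w).

Definition space (M : machine) (c : config M) : nat :=
  (\sum_(i < (tapes M).+1) tape_cells (ctape c i))%N.

Definition contains (M : machine) (t : tape (symbol M)) (w : seq bool) : Prop :=
  (exists m, tleft t = nseq m (blank M)) /\
  (exists m, tright t = map (@bit M) w ++ nseq m (blank M)).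

(** * Complexity *)

Definition language := seq bool -> Prop.

(* Every polynomial over nat is dominated by some n |-> c n^d + c. *)
Definition pbound (c d n : nat) : nat := (c * n ^ d + c)%N.

Definition PSPACE (L : language) : Prop :=
  exists (M : machine) (c d : nat), forall w : seq bool,
    (forall t, (space (run M w t) <= pbound c d (size w))%N) /\
    (exists t, halting (cstate (run M w t)) /\
               (L w <-> accepting (cstate (run M w t)))).

(* The output is on the last tape, with the head on its first letter. Since
   [step] fixes halted configurations, it is enough to look at the final
   instant of the time bound. *)
Definition polytime (f : seq bool -> seq bool) : Prop :=
  exists (M : machine) (c d : nat), forall w : seq bool,
    let C := run M w (pbound c d (size w)) in
    halting (cstate C) /\ contains (ctape C ord_max) (f w).

Definition polytime_reducible (L L' : language) : Prop :=
  exists f, polytime f /\ forall w, L w <-> L' (f w).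

Definition PSPACE_hard (L : language) : Prop :=
  forall L', PSPACE L' -> polytime_reducible L' L.

(** * Arithmetic circuits *)

(* [Add a b] and [Mul a b] refer to earlier gates of the circuit, by their
   position in the list of gates. *)
Inductive gate (F : Type) (k : nat) :=
  | Input of 'I_k
  | Const of F
  | Add of nat & nat
  | Mul of nat & nat.
Arguments Input {F k}.
Arguments Const {F k}.
Arguments Add {F k}.
Arguments Mul {F k}.

Record circuit (F : Type) (k : nat) := Circuit {
  gates : seq (gate F k);
  outputs : seq nat }.

Definition labelled_with (F : Type) (k : nat) (i : 'I_k) (g : gate F k) : bool :=
  if g is Input j then i == j else false.

Definition gate_ok (F : Type) (k : nat) (p : nat) (g : gate F k) : bool :=
  match g with
  | Input _ | Const _ => true
  | Add a b | Mul a b => (a < p)%N && (b < p)%N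
  end.

Definition circuit_ok (F : Type) (k : nat) (C : circuit F k) : bool :=
  [&& all2 (@gate_ok F k) (iota 0 (size (gates C))) (gates C),
      [forall i, count (labelled_with i) (gates C) == 1%N]
    & all (fun o => o < size (gates C))%N (outputs C)].

Definition gate_poly (F : fieldType) (k : nat) (ps : seq {mpoly F[k]})
    (g : gate F k) : {mpoly F[k]} :=
  match g with
  | Input i => 'X_i
  | Const c => c%:MP
  | Add a b => ps`_a + ps`_b
  | Mul a b => ps`_a * ps`_b
  end.

Definition gate_polys (F : fieldType) (k : nat) (gs : seq (gate F k)) :
    seq {mpoly F[k]} :=
  foldl (fun ps g => rcons ps (gate_poly ps g)) [::] gs.

Definition represents (F : fieldType) (k : nat) (C : circuit F k)
    (P : {mpoly F[k]}) : Prop :=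
  circuit_ok C /\ [seq (gate_polys (gates C))`_o | o <- outputs C] = [:: P].

(** * Polynomially recursive sequences and the Skolem problem *)

Fixpoint polyrec (F : fieldType) (k : nat) (P : 'I_k -> {mpoly F[k]})
    (v : 'I_k -> F) (n : nat) : 'I_k -> F :=
  if n is m.+1 then fun i => (P i).@[polyrec P v m] else v.

Record polyrec_input (F : Type) := PolyrecInput {
  dim_pred : nat; (* the dimension is k = dim_pred.+1 >= 1 *)
  init : dim_pred.+1.-tuple F;
  circuits : dim_pred.+1.-tuple (circuit F dim_pred.+1) }.

Definition skolem (F : fieldType) (I : polyrec_input F) : Prop :=
  exists2 P : 'I_(dim_pred I).+1 -> {mpoly F[(dim_pred I).+1]},
    forall i, represents (tnth (circuits I) i) (P i) &
    exists n : nat, polyrec P (tnth (init I)) n ord0 = 0.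

(** * Binary encoding of the inputs over the rationals *)

Definition enc_seq (A : Type) (e : A -> seq bool) (s : seq A) : seq bool :=
  flatten [seq true :: e x | x <- s] ++ [:: false].

(* Used only for variables and gate numbers, which are smaller than the number
   of gates of the circuit: this costs at most a quadratic blow-up. *)
Definition enc_unary (n : nat) : seq bool := nseq n true ++ [:: false].

Fixpoint pos_digits (p : BinNums.positive) : seq bool :=
  match p with
  | BinNums.xH => [:: true]
  | BinNums.xO q => false :: pos_digits q
  | BinNums.xI q => true :: pos_digits q
  end.

(* Binary digits, least significant first. *)
Definition digits (n : nat) : seq bool :=
  if bin_of_nat n is BinNums.Npos p then pos_digits p else [::].

Definition enc_nat (n : nat) : seq bool := enc_seq (fun b => [:: b]) (digits n).

Definition enc_rat (q : rat) : seq bool :=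
  (numq q < 0) :: enc_nat `|numq q|%N ++ enc_nat `|denq q|%N.

Definition enc_gate (k : nat) (g : gate rat k) : seq bool :=
  match g with
  | Input i => [:: false; false] ++ enc_unary i
  | Const q => [:: false; true] ++ enc_rat q
  | Add a b => [:: true; false] ++ enc_unary a ++ enc_unary b
  | Mul a b => [:: true; true] ++ enc_unary a ++ enc_unary b
  end.

Definition enc_circuit (k : nat) (C : circuit rat k) : seq bool :=
  enc_seq (@enc_gate k) (gates C) ++ enc_seq enc_unary (outputs C).

Definition encode (I : polyrec_input rat) : seq bool :=
  enc_seq enc_rat (init I) ++ enc_seq (@enc_circuit _) (circuits I).

Definition skolem_rat : language :=
  fun w => exists2 I : polyrec_input rat, w = encode I & skolem I.

(** * The encoding is injective *)

Definition prefix_code (A : Type) (e : A -> seq bool) : Prop :=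
  forall x y s t, e x ++ s = e y ++ t -> x = y /\ s = t.

Lemma enc_seq_prefix (A : Type) (e : A -> seq bool) :
  prefix_code e -> prefix_code (enc_seq e).
Proof.
move=> he; rewrite /enc_seq; elim=> [|x u IH] [|y v] s t //=.
  by case.
case; rewrite -!catA => /he [-> h].
by have [|-> ->] := IH v s t; rewrite -?catA.
Qed.

Lemma enc_unary_prefix : prefix_code enc_unary.
Proof.
rewrite /enc_unary; elim=> [|m IH] [|n] s t //=; first by case.
by case=> /IH [-> ->].
Qed.

Lemma digits_inj : injective digits.
Proof.
have nz p : pos_digits p <> [::] by case: p.
have pinj : injective pos_digits.
  elim=> [p IH|p IH|] [q|q|] //= [].
  - by move=> /IH ->.
  - by move=> /nz.
  - by move=> /IH ->.
  - by move=> /esym /nz.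
move=> m n; rewrite /digits => h; apply: (can_inj bin_of_natK).
case: (bin_of_nat m) (bin_of_nat n) h => [|p] [|q] //.
- by move=> /esym /nz.
- by move=> /nz.
- by move=> /pinj ->.
Qed.

Lemma enc_nat_prefix : prefix_code enc_nat.
Proof.
move=> m n s t h.
have hb : prefix_code (fun b : bool => [:: b]) by move=> x y ? ? [-> ->].
by have [/digits_inj -> ->] := enc_seq_prefix hb h.
Qed.

Lemma enc_rat_prefix : prefix_code enc_rat.
Proof.
move=> p q s t; rewrite /enc_rat !cat_cons -!(catA (enc_nat _)).
move/eqP; rewrite eqseq_cons => /andP[/eqP hs /eqP].
move=> /enc_nat_prefix [hn /enc_nat_prefix [hd ->]]; split=> //.
have en : numq p = numq q by rewrite (intEsign (numq p)) hs hn -intEsign.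
have ed : denq p = denq q by rewrite -(absz_denq p) hd absz_denq.
by rewrite -(divq_num_den p) en ed divq_num_den.
Qed.

Lemma enc_gate_prefix (k : nat) : prefix_code (@enc_gate k).
Proof.
case=> [i|c|a b|a b] [j|d|a' b'|a' b'] s t //=; rewrite -?(catA (enc_unary _)) => h.
- by case: h => /enc_unary_prefix [/val_inj -> ->].
- by have [-> ->] := @enc_rat_prefix c d s t (congr1 (drop 2) h).
- by case: h => /enc_unary_prefix [-> /enc_unary_prefix [-> ->]].
- by case: h => /enc_unary_prefix [-> /enc_unary_prefix [-> ->]].
Qed.

Lemma enc_circuit_prefix (k : nat) : prefix_code (@enc_circuit k).
Proof.
case=> [g o] [g' o'] s t; rewrite /enc_circuit /= -!(catA (enc_seq _ _)).
move=> /(enc_seq_prefix (@enc_gate_prefix k)) [-> ].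
by move=> /(enc_seq_prefix enc_unary_prefix) [-> ->].
Qed.

Lemma encode_inj : injective encode.
Proof.
case=> [k u C] [l v D]; rewrite /encode /=.
move=> /(enc_seq_prefix enc_rat_prefix) [euv].
have ekl : k = l by apply: succn_inj; rewrite -(size_tuple u) euv size_tuple.
case: l / ekl v D euv => v D /val_inj <- h.
have [|/val_inj -> //] := enc_seq_prefix (@enc_circuit_prefix k.+1) (x := C) (y := D) (s := [::]) (t := [::]).
by rewrite !cats0.
Qed.

(* Main.v *)
From HB Require Import structures.
From mathcomp Require Import all_boot all_order all_algebra.
From mathcomp Require Import mpoly zify.
Require Import Defs.

(* A machine M in polynomial space S is simulated in real time.  The variables
   are the state, and for each tape the scanned cell and the N cells on either
   side, so that the head never moves and a tape shifts instead: a cell becomes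
   A x_{p+1} + B x_{p-1} + C x_p, where exactly one of A, B, C is 1.  The
   coefficients, the written symbols and the next state are functions of the
   state and of the scanned symbols, hence polynomials by Lagrange
   interpolation.  The observed variable is 1 minus the indicator of accepting
   halted states.

   All the circuits share one list of gates and differ only by their output.
   This list is a fixed prologue followed by N translates of one block of gates,
   so the encoding of the instance is printed by nested loops over unary
   counters, and a small language of such loops is compiled to Turing machines
   with a polynomial bound on the running time. *)

Set Implicit Arguments.
Unset Strict Implicit.
Unset Printing Implicit Defensive.

Import GRing.Theory Num.Theory.

(** * Components of Turing machines *)

(** With the scanned cells kept in fixed variables, the transition depends on a number of variables
    fixed by [M], so interpolating it takes a constant number of gates; with moving heads it would
    depend on all the cells. The main constraint is then that a machine has to print the instance.
    Each circuit must have exactly one input gate per variable, and sharing the gate list settles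
    this for all circuits at once. Gate numbers are affine in the block index, so a fixed loop body
    prints them in unary. The initial values are made to be a fixed header, then one row per letter
    of [w], then blank rows: hence an extra initial state in which every head scans a blank, and N =
    S + |w|, where S is the space bound. Space is used at one place: the outermost cells always
    receive the constant blank. The observed variable starts at 1 and lags one step behind the
    state. *)

Definition upd (X : finType) (A : Type) (T : {ffun X -> A}) (x : X) (a : A) :=
  [ffun y => if y == x then a else T y].

Section Upd.
Variables (X : finType) (A : Type).
Implicit Types (T : {ffun X -> A}) (x y : X) (a b : A).

Lemma upd_eq T x a : upd T x a x = a.
Proof. by rewrite ffunE eqxx. Qed.

Lemma upd_neq T x y a : y != x -> upd T x a y = T y.
Proof. by rewrite ffunE => /negPf->. Qed.

Lemma upd_upd T x a b : upd (upd T x a) x b = upd T x b.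
Proof. by apply/ffunP=> y; rewrite !ffunE; case: eqP. Qed.

Lemma upd_id T x : upd T x (T x) = T.
Proof. by apply/ffunP=> y; rewrite !ffunE; case: eqP => [->|]. Qed.

Lemma updC T x y a b : x != y -> upd (upd T x a) y b = upd (upd T y b) x a.
Proof.
move=> xy; apply/ffunP=> z; rewrite !ffunE; case: (eqVneq z y) => [->|//].
by rewrite eq_sym (negPf xy).
Qed.

End Upd.

(** * Tapes up to trailing blanks *)

Local Notation sym := (option bool).

(* Tapes are compared up to trailing blanks; [bcons] keeps lists trimmed. *)
Definition bcons (a : sym) (s : seq sym) : seq sym :=
  if (a == None) && nilp s then [::] else a :: s.

Definition trim (s : seq sym) : seq sym := foldr bcons [::] s.

Lemma head_trim s : head None (trim s) = head None s.
Proof. by case: s => // -[b|] s //=; rewrite /bcons /=; case: nilp. Qed.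

Lemma behead_trim s : behead (trim s) = trim (behead s).
Proof. by case: s => // -[b|] s //=; rewrite /bcons /=; case: nilP. Qed.

Lemma trim_map_Some s : trim (map Some s) = map Some s.
Proof. by elim: s => //= b s ->. Qed.

Lemma trim_cons_behead s : bcons (head None s) (trim (behead s)) = trim s.
Proof. by case: s. Qed.

(** Recovers, from an equality of trimmed lists, the trailing blanks that [contains] allows. *)
Lemma trim_pad s : exists m, s = trim s ++ nseq m None.
Proof.
elim: s => [|a s [m IH]]; first by exists 0.
rewrite /= /bcons; case: andP => [[/eqP-> /nilP e]|_]; last first.
  by exists m; rewrite cat_cons -IH.
by exists m.+1; rewrite {1}IH e.
Qed.

Definition ctp := (seq sym * seq sym)%type.

Definition cread (t : ctp) : sym := head None t.2.
Definition cwrite (a : sym) (t : ctp) : ctp := (t.1, bcons a (behead t.2)).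
Definition cmove (m : move) (t : ctp) : ctp :=
  match m with
  | MoveL => (behead t.1, bcons (head None t.1) t.2)
  | Stay => t
  | MoveR => (bcons (head None t.2) t.1, behead t.2)
  end.

Definition canon (t : tape sym) : ctp := (trim (tleft t), trim (tright t)).

Lemma canon_read t : cread (canon t) = tape_read None t.
Proof. exact: head_trim. Qed.

Lemma canon_write a t : canon (tape_write a t) = cwrite a (canon t).
Proof. by rewrite /canon /cwrite /= behead_trim. Qed.

Lemma canon_move m t : canon (tape_move None m t) = cmove m (canon t).
Proof.
by case: m => //; case: t => l r; rewrite /canon /= ?behead_trim ?head_trim.
Qed.

(** A machine writes on all its tapes at each step. Writing back the scanned symbol may list one
    more blank cell, which trimming forgets; so a program step acting on one tape leaves the others
    unchanged. *)
Lemma canon_noop t : canon (tape_write (tape_read None t) t) = canon t.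
Proof. by rewrite /canon /= trim_cons_behead. Qed.

(** * Sequential programs on finitely many tapes, with time bounds *)

Section Components.
Variable X : finType.

Notation tps := {ffun X -> ctp}.
Implicit Types (T : tps) (x : X) (p : pred sym).

(* [nxt] returns the next state, [None] being the exit, and what to do on one
   of the tapes. *)
Record comp := Comp {
  cQ : finType;
  cq0 : cQ;
  nxt : cQ -> {ffun X -> sym} -> option cQ * option (X * (sym * move)) }.
Arguments cq0 : clear implicits.

Definition capply (o : option (X * (sym * move))) (T : tps) : tps :=
  if o is Some (x, (a, m)) then upd T x (cmove m (cwrite a (T x))) else T.

Definition reads (T : tps) : {ffun X -> sym} := [ffun x => cread (T x)].

Definition cstep (A : comp) (c : option (cQ A) * tps) : option (cQ A) * tps :=
  if c.1 is Some q then
    let r := nxt q (reads c.2) in (r.1, capply r.2 c.2)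
  else c.

(** The exit is accepted with any budget left, so [t] is an upper bound on the time; branches and
    rounds of different lengths can share one bound. *)
Inductive reach (A : comp) : option (cQ A) -> tps -> nat -> tps -> Prop :=
| reach_exit T t : reach None T t T
| reach_step q T t T' :
    reach (nxt q (reads T)).1 (capply (nxt q (reads T)).2 T) t T' ->
    reach (Some q) T t.+1 T'.

Definition exec (A : comp) (T : tps) (t : nat) (T' : tps) : Prop :=
  reach (Some (cq0 A)) T t T'.

Lemma reach_mono (A : comp) (o : option (cQ A)) T t t' T' :
  t <= t' -> reach o T t T' -> reach o T t' T'.
Proof.
move=> le h; elim: h t' le => {o T t T'} [T t|q T t T' _ IH] t' le.
  exact: reach_exit.
by case: t' le => // t' le; apply: reach_step; apply: IH.
Qed.

Lemma exec_le (A : comp) T t t' T' : exec A T t T' -> t <= t' -> exec A T t' T'.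
Proof. by move=> h le; apply: reach_mono h. Qed.

Lemma reach_iter (A : comp) (o : option (cQ A)) T t T' :
  reach o T t T' -> iter t (@cstep A) (o, T) = (None, T').
Proof.
elim=> {o T t T'} [T t|q T t T' _ IH]; first by elim: t => // t IH; rewrite iterS IH.
by rewrite iterSr /cstep /= IH.
Qed.

Definition act (x : X) (f : sym -> sym * move) : comp :=
  @Comp unit tt (fun _ r => (None, Some (x, f (r x)))).

Definition skip : comp := @Comp unit tt (fun _ r => (None, None)).

Definition op (x : X) (a : sym) (m : move) : comp := act x (fun _ => (a, m)).
Definition mv (x : X) (m : move) : comp := act x (fun a => (a, m)).

Definition Seq (A B : comp) : comp :=
  @Comp (cQ A + cQ B)%type (inl (cq0 A)) (fun q r =>
    match q with
    | inl q => let n := nxt q r in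
               (Some (if n.1 is Some q' then inl q' else inr (cq0 B)), n.2)
    | inr q => let n := nxt q r in (omap inr n.1, n.2)
    end).

(** State [None] is the test, so the exit [None] of the body, once wrapped in [Some], is already the
    jump back to the test. *)
Definition While (x : X) (p : pred sym) (A : comp) : comp :=
  @Comp (option (cQ A)) None (fun q r =>
    match q with
    | None => (if p (r x) then Some (Some (cq0 A)) else None, None)
    | Some q => let n := nxt q r in (Some n.1, n.2)
    end).

Definition If (x : X) (p : pred sym) (A B : comp) : comp :=
  @Comp (option (cQ A + cQ B)%type) None (fun q r =>
    match q with
    | None => (Some (Some (if p (r x) then inl (cq0 A) else inr (cq0 B))), None)
    | Some (inl q) => let n := nxt q r in (omap (Some \o inl) n.1, n.2)
    | Some (inr q) => let n := nxt q r in (omap (Some \o inr) n.1, n.2)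
    end).

Lemma exec_op x a m T : exec (op x a m) T 1 (upd T x (cmove m (cwrite a (T x)))).
Proof. by apply: reach_step; apply: reach_exit. Qed.

Lemma exec_skip T : exec skip T 1 T.
Proof. by apply: reach_step; apply: reach_exit. Qed.

Lemma exec_mv x m T :
  exec (mv x m) T 1 (upd T x (cmove m (cwrite (cread (T x)) (T x)))).
Proof.
apply: reach_step; rewrite /= ffunE; exact: reach_exit.
Qed.

Lemma exec_Seq A B T t1 T1 t2 T2 :
  exec A T t1 T1 -> exec B T1 t2 T2 -> exec (Seq A B) T (t1 + t2) T2.
Proof.
move=> hA hB.
have hB' (o : option (cQ B)) S t S' :
    reach o S t S' -> @reach (Seq A B) (omap inr o) S t S'.
  elim=> {o S t S'} [S t|q S t S' _ IH]; first exact: reach_exit.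
  by apply: reach_step.
suff: forall (o : option (cQ A)), reach o T t1 T1 ->
    @reach (Seq A B) (Some (if o is Some q then inl q else inr (cq0 B))) T (t1 + t2) T2.
  by move/(_ _ hA).
move=> o h; elim: h hB => {hA o T t1 T1} [T t|q T t T1 _ IH] hB.
  by apply: reach_mono (hB' _ _ _ _ hB); apply: leq_addl.
by rewrite addSn; apply: reach_step; apply: IH.
Qed.

Lemma exec_While_exit x p A T : ~~ p (cread (T x)) -> exec (While x p A) T 1 T.
Proof.
move=> h; apply: reach_step; rewrite /= ffunE (negPf h); exact: reach_exit.
Qed.

Lemma exec_While_loop x p A T t1 T1 t2 T2 :
  p (cread (T x)) -> exec A T t1 T1 -> exec (While x p A) T1 t2 T2 ->
  exec (While x p A) T (t1 + t2).+1 T2.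
Proof.
move=> h hA hW; apply: reach_step; rewrite /= ffunE h /=.
suff: forall (o : option (cQ A)), reach o T t1 T1 ->
    @reach (While x p A) (Some o) T (t1 + t2) T2.
  by move/(_ _ hA).
move=> o ho; elim: ho hW => {hA h o T t1 T1} [T t|q T t T1 _ IH] hW.
  by apply: reach_mono hW; apply: leq_addl.
by rewrite addSn; apply: reach_step; apply: IH.
Qed.

Lemma exec_If x p A B T t T' :
  exec (if p (cread (T x)) then A else B) T t T' -> exec (If x p A B) T t.+1 T'.
Proof.
move=> h; apply: reach_step; rewrite /= ffunE.
case: (p _) h => h.
- suff: forall (o : option (cQ A)), reach o T t T' ->
      @reach (If x p A B) (omap (Some \o inl) o) T t T' by move/(_ _ h).
  move=> o; elim=> {h o T t T'} [T t|q T t T' _ IH]; first exact: reach_exit.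
  exact: reach_step.
suff: forall (o : option (cQ B)), reach o T t T' ->
    @reach (If x p A B) (omap (Some \o inr) o) T t T' by move/(_ _ h).
move=> o; elim=> {h o T t T'} [T t|q T t T' _ IH]; first exact: reach_exit.
exact: reach_step.
Qed.

End Components.

(** * From programs to Turing machines *)

Section ToMachine.
Variables (m : nat) (A : comp 'I_m.+1).

Definition mdelta (o : option (cQ A)) (r : {ffun 'I_m.+1 -> sym}) :
    option (cQ A) * {ffun 'I_m.+1 -> sym * move} :=
  if o is Some q then
    let n := nxt q r in
    (n.1, [ffun i => if n.2 is Some (x, am) then
                       if i == x then am else (r i, Stay) else (r i, Stay)])
  else (None, [ffun i => (r i, Stay)]).

Definition to_machine : machine :=
  @Machine sym (option (cQ A)) m None Some (@Some_inj _) (fun b => isT)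
    (Some (cq0 A)) (fun o => o == None) predT mdelta.

Definition mabs (c : config to_machine) : option (cQ A) * {ffun 'I_m.+1 -> ctp} :=
  (cstate c, [ffun i => canon (ctape c i)]).

Lemma mabs_step c : mabs (step c) = cstep (mabs c).
Proof.
rewrite /mabs /step /cstep; case E: (cstate c) => [q|] /=; last by rewrite E.
have -> : reads [ffun i => canon (ctape c i)] = [ffun i => tape_read None (ctape c i)].
  by apply/ffunP=> i; rewrite !ffunE canon_read.
set n := nxt _ _; congr (_, _); apply/ffunP=> i; rewrite !ffunE.
case: n.2 => [[x [a d]]|] /=; rewrite !ffunE ?canon_noop //.
case: eqP => [->|_] /=; rewrite ?canon_noop // canon_move canon_write //.
Qed.

Lemma run_exec w t T :
  exec A [ffun i => if i == ord0 then ([::], map Some w) else ([::], [::])] t T ->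
  let C := run to_machine w t in
  halting (cstate C) /\ (forall i, canon (ctape C i) = T i).
Proof.
move=> /reach_iter h.
have e : mabs (run to_machine w t) = (None, T).
  rewrite -h /run; set c := initial _ _.
  have -> : (Some (cq0 A), [ffun i : 'I_m.+1 => if i == ord0 then ([::], map Some w)
                                     else ([::], [::])]) = mabs c.
    rewrite /mabs /c /=; congr (_, _); apply/ffunP=> i; rewrite !ffunE.
    by case: eqP => _ //; rewrite /canon /= trim_map_Some.
  by elim: t {h} => // t IH; rewrite !iterS mabs_step IH.
move: e; rewrite /mabs => -[e1 e2] /=; split; first by rewrite e1.
by move=> i; rewrite -e2 ffunE.
Qed.

End ToMachine.

(** * Nested loops over unary counters *)

Section Generators.
Variable X : finType.

Notation tps := {ffun X -> ctp}.
Implicit Types (T : tps) (x y s o : X) (p : pred sym) (A B : comp X).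

(** The invariant is a sequence [F] of exact tape contents. Each round pays for its body and one
    test, and a last test leaves the loop. *)
Lemma exec_While_iter x p A (F : nat -> tps) n c :
  (forall k, k < n -> p (cread (F k x))) -> ~~ p (cread (F n x)) ->
  (forall k, k < n -> exec A (F k) c (F k.+1)) ->
  exec (While x p A) (F 0) (n * c.+1).+1 (F n).
Proof.
elim: n F => [|n IH] F hp hn hA; first exact: exec_While_exit.
have h : exec (While x p A) (F 1) (n * c.+1).+1 (F n.+1).
  by apply: (IH (F \o S)) => // k lt; [apply: hp | apply: hA].
apply: exec_le (exec_While_loop (hp 0 isT) (hA 0 isT) h) _; lia.
Qed.

Lemma exec_op_to x a m T T' :
  T' = upd T x (cmove m (cwrite a (T x))) -> exec (op x a m) T 1 T'.
Proof. by move->; apply: exec_op. Qed.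

Lemma exec_mv_to x m T T' :
  T' = upd T x (cmove m (cwrite (cread (T x)) (T x))) ->
  exec (mv x m) T 1 T'.
Proof. by move->; apply: exec_mv. Qed.

Fixpoint cemit o (w : seq bool) : comp X :=
  if w is b :: w' then Seq (op o (Some b) MoveR) (cemit o w') else skip X.

Lemma exec_cemit o w T l : T o = (l, [::]) ->
  exec (cemit o w) T (size w).+1 (upd T o (catrev (map Some w) l, [::])).
Proof.
elim: w T l => [|b w IH] T l e /=; first by rewrite -e upd_id; apply: exec_skip.
have h := IH _ _ (upd_eq T o (Some b :: l, [::])); rewrite upd_upd in h.
have h0 : exec (op o (Some b) MoveR) T 1 (upd T o (Some b :: l, [::])).
  by apply: exec_op_to; rewrite e.
exact: exec_Seq h0 h.
Qed.

Lemma cwrite_read (l : seq sym) (w : seq bool) :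
  cwrite (cread (l, map Some w)) (l, map Some w) = (l, map Some w).
Proof. by case: w. Qed.

Lemma cwrite_read_blank (l : seq sym) (w : seq bool) :
  cwrite (cread (l, bcons None (map Some w))) (l, bcons None (map Some w)) =
  (l, bcons None (map Some w)).
Proof. by case: w. Qed.

(* On counter tapes, the cells of value [false] to the left of the head count
   the completed rounds and the cells of value [true] the remaining ones. *)
Definition counter (i r : nat) : ctp := (nseq i (Some false), nseq r (Some true)).

(** The head walks left over the completed rounds, printing one [true] for each, and walks back: the
    counter is read without being changed. *)
Definition cpow o y : comp X :=
  Seq (mv y MoveL)
  (Seq (While y (pred1 (Some false)) (Seq (op o (Some true) MoveR) (mv y MoveL)))
  (Seq (mv y MoveR)
       (While y (pred1 (Some false)) (mv y MoveR)))).

Lemma exec_cpow o y T l i r : o != y -> T o = (l, [::]) -> T y = counter i r ->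
  exec (cpow o y) T (5 * i + 4) (upd T o (nseq i (Some true) ++ l, [::])).
Proof.
move=> oy eo ey.
have yo : y != o by rewrite eq_sym.
pose w k := nseq k false ++ nseq r true.
have mw k : map Some (w k) = nseq k (Some false) ++ nseq r (Some true).
  by rewrite map_cat !map_nseq.
(* The tape is written as a left move still to be applied; this also covers the end of the walk,
   where the head lands on the blank cell before the counter. *)
pose Y k : ctp := cmove MoveL (nseq (i - k) (Some false), map Some (w k)).
pose F k := upd (upd T o (nseq k (Some true) ++ l, [::])) y (Y k).
pose G k := upd (upd T o (nseq i (Some true) ++ l, [::])) y
                (nseq k (Some false), map Some (w (i - k))).
have h1 : exec (mv y MoveL) T 1 (F 0).
  apply: exec_mv_to; apply/ffunP=> z; rewrite !ffunE; case: eqP => [_|_]; last first.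
    by case: eqP => [->|//]; rewrite eo.
    rewrite ey /counter -(map_nseq _ Some true) cwrite_read /Y /= subn0.
    by rewrite /w /= map_nseq.
have h2 : exec (While y (pred1 (Some false))
    (Seq (op o (Some true) MoveR) (mv y MoveL))) (F 0) (i * 3).+1 (F i).
  apply: exec_While_iter => [k lt||k lt].
  - by rewrite /F upd_eq /Y /= -(subnSK lt) /= ; case: (w k).
  - by rewrite /F upd_eq /Y subnn /=; case: (w i).
  rewrite -[2]/(1 + 1); apply: exec_Seq (exec_op _ _ _ _) _.
  apply: exec_mv_to; apply/ffunP=> z; rewrite !ffunE.
  have -> : (y == o) = false by exact: negbTE.
  rewrite eqxx; case: eqP => [_|zy]; last first.
    by rewrite (negPf oy) eqxx; case: (z == o).
  rewrite /Y -(subnSK lt) /=.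
  by [].
have h3 : exec (mv y MoveR) (F i) 1 (G 0).
  apply: exec_mv_to; apply/ffunP=> z; rewrite !ffunE; case: eqP => // _.
  have -> : Y i = ([::], bcons None (map Some (w i))) by rewrite /Y subnn.
  by rewrite eqxx subn0 cwrite_read_blank; case: (w i).
have h4 : exec (While y (pred1 (Some false)) (mv y MoveR)) (G 0) (i * 2).+1 (G i).
  apply: exec_While_iter => [k lt||k lt].
  - by rewrite /G upd_eq mw -(subnSK lt).
  - by rewrite /G upd_eq subnn /w /=; case: (r).
  apply: exec_mv_to; apply/ffunP=> z; rewrite !ffunE eqxx; case: eqP => // _.
  by rewrite cwrite_read -(subnSK lt).
have -> : upd T o (nseq i (Some true) ++ l, [::]) = G i.
  apply/ffunP=> z; rewrite !ffunE subnn mw; case: (eqVneq z y) => [->|//].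
  by rewrite (negPf yo) ey.
apply: exec_le (exec_Seq h1 (exec_Seq h2 (exec_Seq h3 h4))) _; lia.
Qed.

(** Only the length of the source matters. It is copied in unary to [y], and the source is put back
    before the body runs, so nested loops may share a source. Finally [y] is erased, ready for
    reuse. *)
Definition cfor s y (body : comp X) : comp X :=
  Seq (mv s MoveL)
  (Seq (While s isSome (Seq (op y (Some true) MoveL) (mv s MoveL)))
  (Seq (mv s MoveR)
  (Seq (mv y MoveR)
  (Seq (While s isSome (mv s MoveR))
  (Seq (While y (pred1 (Some true)) (Seq body (op y (Some false) MoveR)))
  (Seq (mv y MoveL)
       (While y (pred1 (Some false)) (op y None MoveL)))))))).

(** [U i] describes the tapes after [i] rounds, with the current counter overlaid on [y]. A family
    is needed because what the body does depends on the round. *)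
Lemma exec_cfor s y body (a : seq bool) (U : nat -> tps) c :
  s != y -> U 0 s = (map Some a, [::]) -> U 0 y = ([::], [::]) ->
  (forall i, i < size a ->
     exec body (upd (U i) y (counter i (size a - i))) c
               (upd (U i.+1) y (counter i (size a - i)))) ->
  exec (cfor s y body) (U 0) (size a * (c + 9) + 8)
       (upd (U (size a)) y ([::], [::])).
Proof.
move=> sy es ey hb; set n := size a; set T := U 0.
have ys : (y == s) = false by rewrite eq_sym; exact: negbTE.
pose A k : ctp := cmove MoveL (map Some (drop k a), map Some (catrev (take k a) [::])).
pose F k := upd (upd T s (A k)) y ([::], bcons None (nseq k (Some true))).
pose G k := upd (upd T s (map Some (catrev (take k (rev a)) [::]), map Some (drop k (rev a))))
                y ([::], nseq n (Some true)).
pose H i := upd (U i) y (counter i (n - i)).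
pose K k := upd (U n) y (cmove MoveL (nseq (n - k) (Some false), [::])).
have h1 : exec (mv s MoveL) T 1 (F 0).
  apply: exec_mv_to; apply/ffunP=> z; rewrite !ffunE.
  case: (eqVneq z y) => [->|zy]; first by rewrite ys ey.
  by case: (z == s) => //; rewrite es (cwrite_read _ [::]) /A take0 drop0.
have h2 : exec (While s isSome (Seq (op y (Some true) MoveL) (mv s MoveL)))
               (F 0) (n * 3).+1 (F n).
  apply: exec_While_iter => [k lt||k lt].
  - by rewrite /F upd_neq // upd_eq /A (drop_nth false lt).
  - rewrite /F upd_neq // upd_eq /A drop_size take_size /=.
    by case: (catrev a [::]).
  rewrite -[2]/(1 + 1); apply: exec_Seq (exec_op _ _ _ _) _.
  apply: exec_mv_to; apply/ffunP=> z; rewrite !ffunE eqxx (negPf sy) eqxx.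
  case: (eqVneq z y) => [->|zy]; first by rewrite ys; case: (k).
  case: (z == s) => //; rewrite /A (drop_nth false lt) (take_nth false lt).
  by rewrite !catrevE !cats0 rev_rcons.
have h3 : exec (mv s MoveR) (F n) 1
    (upd (upd T s ([::], map Some (rev a))) y ([::], bcons None (nseq n (Some true)))).
  apply: exec_mv_to; apply/ffunP=> z; rewrite !ffunE eqxx (negPf sy).
  case: (eqVneq z y) => [->|zy]; first by rewrite ?ys.
  case: (z == s) => //; rewrite /A drop_size take_size catrevE cats0.
  by rewrite /cmove cwrite_read_blank; case: (rev a).
have h4 : exec (mv y MoveR)
    (upd (upd T s ([::], map Some (rev a))) y ([::], bcons None (nseq n (Some true)))) 1 (G 0).
  apply: exec_mv_to; apply/ffunP=> z; rewrite !ffunE eqxx.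
  case: (z == y); last by rewrite take0 drop0.
  by rewrite -(map_nseq _ Some true) cwrite_read_blank; case: (n).
have h5 : exec (While s isSome (mv s MoveR)) (G 0) (n * 2).+1 (G n).
  have sr : size (rev a) = n by rewrite size_rev.
  apply: exec_While_iter => [k lt||k lt].
  - by rewrite /G upd_neq // upd_eq (drop_nth false) ?sr.
  - by rewrite /G upd_neq // upd_eq -sr drop_size.
  have ltr : k < size (rev a) by rewrite sr.
  apply: exec_mv_to; apply/ffunP=> z; rewrite !ffunE eqxx (negPf sy).
  case: (eqVneq z y) => [->|zy]; first by rewrite ?ys.
  case: (z == s) => //; rewrite (drop_nth false ltr) (take_nth false ltr).
  by rewrite !catrevE !cats0 rev_rcons.
have eGH : G n = H 0.
  rewrite /G /H /counter subn0 /=; apply/ffunP=> z; rewrite !ffunE.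
  case: (z == y) => //; case: (eqVneq z s) => [->|//].
  by rewrite -[n](size_rev a) take_size drop_size catrevE cats0 revK -/T es.
have h6 : exec (While y (pred1 (Some true)) (Seq body (op y (Some false) MoveR)))
               (H 0) (n * (c + 1).+1).+1 (H n).
  apply: exec_While_iter => [k lt||k lt].
  - by rewrite /H upd_eq -(subnSK lt).
  - by rewrite /H upd_eq subnn.
  apply: exec_Seq (hb _ lt) _; apply: exec_op_to; rewrite upd_eq upd_upd.
  by rewrite /H -/n -(subnSK lt).
have h7 : exec (mv y MoveL) (H n) 1 (K 0).
  apply: exec_mv_to; rewrite upd_eq upd_upd /K /counter subnn subn0.
  by rewrite (cwrite_read _ [::]).
have h8 : exec (While y (pred1 (Some false)) (op y None MoveL)) (K 0) (n * 2).+1 (K n).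
  apply: exec_While_iter => [k lt||k lt].
  - by rewrite /K upd_eq -(subnSK lt).
  - by rewrite /K upd_eq subnn.
  by apply: exec_op_to; rewrite upd_eq upd_upd /K -(subnSK lt).
have -> : upd (U n) y ([::], [::]) = K n by rewrite /K subnn.
rewrite eGH in h5.
apply: exec_le (exec_Seq h1 (exec_Seq h2 (exec_Seq h3 (exec_Seq h4 (exec_Seq h5
  (exec_Seq h6 (exec_Seq h7 h8))))))) _; nia.
Qed.

End Generators.

(** * The loop language: semantics, compilation and cost *)

Section GeneratorLanguage.
Variable X : finType.

Inductive gen :=
| GEmit of seq bool
| GCat of gen & gen
| GPow of X
| GFor of X & X & gen.

Fixpoint geval (e : {ffun X -> nat}) (g : gen) : seq bool :=
  match g with
  | GEmit w => w
  | GCat g h => geval e g ++ geval e h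
  | GPow y => nseq (e y) true
  | GFor s y g => flatten [seq geval (upd e y i) g | i <- iota 0 (e s)]
  end.

Fixpoint cgen (o : X) (g : gen) : comp X :=
  match g with
  | GEmit w => cemit o w
  | GCat g h => Seq (cgen o g) (cgen o h)
  | GPow y => cpow o y
  | GFor s y g => cfor s y (cgen o g)
  end.

Fixpoint gcost (B : nat) (g : gen) : nat :=
  match g with
  | GEmit w => (size w).+1
  | GCat g h => gcost B g + gcost B h
  | GPow y => 5 * B + 4
  | GFor s y g => B * (gcost B g + 9) + 8
  end.

Variables (isrc iloop : pred X) (o : X).
Hypotheses (osrc : ~~ isrc o) (oloop : ~~ iloop o).
Hypothesis src_loop : forall x, isrc x -> ~~ iloop x.

(* [bs] lists the variables of the enclosing loops. *)
Fixpoint gwf (bs : seq X) (g : gen) : bool :=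
  match g with
  | GEmit w => true
  | GCat g h => gwf bs g && gwf bs h
  | GPow y => y \in bs
  | GFor s y g => [&& isrc s, iloop y, y \notin bs & gwf (y :: bs) g]
  end.

(** A body consults only the number of completed rounds, so the number [r] of remaining ones is left
    unspecified. Sources have their head just past the last letter, where [cfor] starts. *)
Definition ginv (B : nat) (e : {ffun X -> nat}) (bs : seq X)
    (T : {ffun X -> ctp}) : Prop :=
  [/\ forall x, isrc x -> e x <= B /\
        exists2 a : seq bool, T x = (map Some a, [::]) & size a = e x,
      forall x, x \in bs -> [/\ iloop x, e x <= B & exists r, T x = counter (e x) r]
    & forall x, iloop x -> x \notin bs -> T x = ([::], [::])].

(** The output lies to the left of the head, hence reversed by [catrev]. This is also the form
    required of a source, so a printed unary number can bound later loops. *)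
Lemma exec_cgen g B e bs T l :
  gwf bs g -> ginv B e bs T -> T o = (l, [::]) ->
  exec (cgen o g) T (gcost B g)
       (upd T o (catrev (map Some (geval e g)) l, [::])).
Proof.
elim: g e bs T l => [w|g IHg h IHh|y|s y g IH] e bs T l /=.
- by move=> _ _ /exec_cemit; apply.
- case/andP=> wg wh inv eT.
  have h1 := IHg _ _ _ _ wg inv eT.
  rewrite map_cat catrev_catl; apply: exec_Seq h1 _.
  set T1 := upd T o _.
  have inv1 : ginv B e bs T1.
    case: inv => i1 i2 i3; split=> x hx.
    + by rewrite upd_neq; [exact: i1|apply: contraNneq osrc => <-].
    + case: (i2 x hx) => lx eb er; split=> //.
      by rewrite upd_neq; [exact: er|apply: contraNneq oloop => <-].
    + by move=> xb; rewrite upd_neq; [exact: i3|apply: contraNneq oloop => <-].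
  have := IHh _ _ _ _ wh inv1 (upd_eq _ _ _).
  by rewrite /T1 upd_upd.
- move=> yb [_ /(_ _ yb) [ly eb [r er]] _] eT.
  have oy : o != y by apply: contraNneq oloop => ->.
  rewrite map_nseq catrevE rev_nseq.
  by apply: exec_le (exec_cpow oy eT er) _; lia.
case/and4P=> hs hy yb wg inv eT.
have [i1 i2 i3] := inv.
have [esB [a ea sa]] := i1 _ hs.
have sy : s != y by apply: contraTneq hs => ->; apply: contraTN hy; apply: src_loop.
have so : s != o by apply: contraNneq osrc => <-.
have yo : y != o by apply: contraNneq oloop => <-.
pose U i := upd T o (catrev (map Some
  (flatten [seq geval (upd e y i) g | i <- iota 0 i])) l, [::]).
have U0 : U 0 = T by rewrite /U /= -eT upd_id.
have hb i : i < size a -> exec (cgen o g) (upd (U i) y (counter i (size a - i)))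
    (gcost B g) (upd (U i.+1) y (counter i (size a - i))).
  rewrite sa => lt.
  have invi : ginv B (upd e y i) (y :: bs) (upd (U i) y (counter i (e s - i))).
    split=> x hx.
    - have xy : x != y by apply: contraTneq hx => ->; apply: contraTN hy; apply: src_loop.
      have xo : x != o by apply: contraNneq osrc => <-.
      by rewrite !upd_neq //; apply: i1.
    - case: (eqVneq x y) hx => [-> _|xy].
        by rewrite !upd_eq; split=> //; [lia | exists (e s - i)].
      rewrite inE (negPf xy) /= => xb; case: (i2 _ xb) => lx eb er.
      have xo : x != o by apply: contraNneq oloop => <-.
      by rewrite !upd_neq.
    - rewrite inE negb_or => /andP[xy xb].
      have xo : x != o by apply: contraNneq oloop => <-.
      by rewrite !upd_neq //; apply: i3.
  have eo : upd (U i) y (counter i (e s - i)) o =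
     (catrev (map Some (flatten [seq geval (upd e y i) g | i <- iota 0 i])) l, [::]).
    by rewrite upd_neq 1?eq_sym // upd_eq.
  have := IH _ _ _ _ wg invi eo.
  have -> : upd (upd (U i) y (counter i (e s - i))) o
    (catrev (map Some (geval (upd e y i) g)) (catrev (map Some
       (flatten [seq geval (upd e y i0) g | i0 <- iota 0 i])) l), [::]) =
    upd (U i.+1) y (counter i (e s - i)); last by [].
  rewrite updC // /U !upd_upd -catrev_catl -map_cat.
  by rewrite -[i.+1]addn1 iotaD (map_cat (fun i => geval (upd e y i) g)) flatten_cat /= cats0.
have := exec_cfor sy _ _ hb; rewrite U0 => /(_ ea (i3 _ hy yb)) h.
have -> : upd T o (catrev (map Some
     (flatten [seq geval (upd e y i) g | i <- iota 0 (e s)])) l, [::])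
   = upd (U (size a)) y ([::], [::]).
  by rewrite /U sa updC 1?eq_sym // -(i3 _ hy yb) upd_id.
apply: exec_le h _; rewrite sa leq_add2r leq_mul2r; by rewrite esB orbT.
Qed.

End GeneratorLanguage.

(** * Polynomial bounds *)

Section PolynomialBounds.

(** The base [n.+1] is positive, so its powers increase with the exponent and bounds add up without
    a special case at 0. *)
Definition polyb (f : nat -> nat) : Prop :=
  exists c d, forall n, f n <= c * n.+1 ^ d.

Lemma polyb_le (f g : nat -> nat) : (forall n, f n <= g n) -> polyb g -> polyb f.
Proof. by move=> fg [c [d h]]; exists c, d => n; apply: leq_trans (h n). Qed.

Lemma polyb_const c : polyb (fun=> c).
Proof. by exists c, 0 => n; rewrite muln1. Qed.

Lemma polyb_id : polyb id.
Proof. by exists 1, 1 => n; rewrite mul1n expn1. Qed.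

Lemma polyb_add f g : polyb f -> polyb g -> polyb (fun n => f n + g n).
Proof.
move=> [c1 [d1 h1]] [c2 [d2 h2]]; exists (c1 + c2), (d1 + d2) => n.
rewrite mulnDl; apply: leq_add.
  by apply: leq_trans (h1 n) _; rewrite leq_mul // leq_pexp2l // leq_addr.
by apply: leq_trans (h2 n) _; rewrite leq_mul // leq_pexp2l // leq_addl.
Qed.

Lemma polyb_mul f g : polyb f -> polyb g -> polyb (fun n => f n * g n).
Proof.
move=> [c1 [d1 h1]] [c2 [d2 h2]]; exists (c1 * c2), (d1 + d2) => n.
by rewrite expnD mulnACA leq_mul.
Qed.

Lemma polyb_comp f g : polyb f -> polyb g -> polyb (f \o g).
Proof.
move=> [c1 [d1 h1]] [c2 [d2 h2]]; exists (c1 * c2.+1 ^ d1), (d2 * d1) => n.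
apply: leq_trans (h1 _) _; rewrite -mulnA leq_mul2l; apply/orP; right.
rewrite expnM -expnMn; case: d1 {h1} => // d1; rewrite leq_exp2r // mulSn.
by rewrite -add1n; apply: leq_add; rewrite ?expn_gt0.
Qed.

Lemma polyb_exp f d : polyb f -> polyb (fun n => f n ^ d).
Proof.
move=> hf; elim: d => [|d IH]; first exact: polyb_const.
by apply: polyb_le (polyb_mul hf IH) => n; rewrite expnS.
Qed.

Lemma polyb_pbound c d : polyb (pbound c d).
Proof.
apply: polyb_add (polyb_const c); apply: polyb_mul (polyb_const c) _.
exact: polyb_exp polyb_id.
Qed.

Lemma polyb_dominated f : polyb f -> exists c d, forall n, f n <= pbound c d n.
Proof.
move=> [c [d h]]; exists (c * 2 ^ d), d => n; apply: leq_trans (h n) _.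
rewrite /pbound -mulnSr -mulnA leq_mul2l; apply/orP; right.
(* The additive constant of [pbound] covers [n = 0]; otherwise [n.+1] is at most [2 * n], whence the
   factor [2 ^ d]. *)
have [->|n0] := posnP n; first by rewrite exp1n muln_gt0 expn_gt0.
apply: leq_trans (_ : (2 * n) ^ d <= _); last by rewrite expnMn leq_mul2l leqnSn orbT.
by case: d {h} => // d; rewrite leq_exp2r //; lia.
Qed.

Lemma polyb_gcost (X : finType) (g : gen X) : polyb (fun B => gcost B g).
Proof.
elim: g => [w|g IHg h IHh|y|s y g IH] /=.
- exact: polyb_const.
- exact: polyb_add.
- by apply: polyb_add (polyb_const _); apply: polyb_mul (polyb_const _) polyb_id.
apply: polyb_add (polyb_const _); apply: polyb_mul polyb_id _.
exact: polyb_add IH (polyb_const _).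
Qed.

End PolynomialBounds.

Lemma size_geval (X : finType) (B : nat) (e : {ffun X -> nat}) (g : gen X) :
  (forall x, e x <= B) -> size (geval e g) <= gcost B g.
Proof.
elim: g e => [w|g IHg h IHh|y|s y g IH] e eB /=.
- exact: leqW.
- by rewrite size_cat leq_add ?IHg ?IHh.
- by rewrite size_nseq; have := eB y; lia.
have h n : n <= e s ->
    size (flatten [seq geval (upd e y i) g | i <- iota 0 n]) <= n * gcost B g.
  elim: n => // n IHn lt; rewrite -[n.+1]addn1 iotaD map_cat flatten_cat size_cat.
  rewrite mulnDl mul1n; apply: leq_add; first by apply: IHn; lia.
  rewrite /= cats0; apply: IH => x.
  by rewrite ffunE; case: eqP => // _; have := eB s; lia.
apply: leq_trans (h _ (leqnn _)) _.
have le := leq_mul (eB s) (leqnn (gcost B g)).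
apply: leq_trans le _; rewrite mulnDr; lia.
Qed.

Lemma flatten_nseq_iota (T : Type) (x : T) m b n :
  flatten [seq nseq m x | i <- iota b n] = nseq (n * m) x.
Proof. by elim: n b => //= n IH b; rewrite IH mulSn -nseqD. Qed.

(** [polytime] expects the head on the first letter of the output, whereas [cgen] leaves it past the
    last one. *)
Definition rewind (X : finType) (o : X) : comp X :=
  Seq (mv o MoveL) (Seq (While o isSome (mv o MoveL)) (mv o MoveR)).

Lemma exec_rewind (X : finType) (o : X) (a : seq bool) (T : {ffun X -> ctp}) :
  T o = (map Some a, [::]) ->
  exec (rewind o) T (2 * size a + 3) (upd T o ([::], map Some (rev a))).
Proof.
move=> eo.
pose A k : ctp := cmove MoveL (map Some (drop k a), map Some (catrev (take k a) [::])).
have h1 : exec (mv o MoveL) T 1 (upd T o (A 0)).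
  by apply: exec_mv_to; rewrite eo (cwrite_read _ [::]) /A drop0 take0.
have h2 : exec (While o isSome (mv o MoveL)) (upd T o (A 0)) (size a * 2).+1
               (upd T o (A (size a))).
  apply: (exec_While_iter (F := fun k => upd T o (A k))) => [k lt||k lt].
  - by rewrite upd_eq /A (drop_nth false lt).
  - by rewrite upd_eq /A drop_size take_size; case: (catrev a [::]).
  apply: exec_mv_to; rewrite upd_eq upd_upd; congr (upd _ _ _).
  rewrite /A (drop_nth false lt) (take_nth false lt).
  by rewrite !catrevE !cats0 rev_rcons.
have h3 : exec (mv o MoveR) (upd T o (A (size a))) 1 (upd T o ([::], map Some (rev a))).
  apply: exec_mv_to; rewrite upd_eq upd_upd; congr (upd _ _ _).
  rewrite /A drop_size take_size catrevE cats0 /cmove cwrite_read_blank.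
  by case: (rev a).
apply: exec_le (exec_Seq h1 (exec_Seq h2 h3)) _; lia.
Qed.

(** * Generated functions are computable in polynomial time *)

Section GeneratedFunctions.
Variables c d : nat.

Notation X := 'I_(d + 5).+1.
(** Tape 0 is the input, tapes 1 and 2 receive the space bound S and S + |w| in unary, and the last
    tape is the output. The [d + 2] tapes between are loop counters: [d] nested loops produce the
    power in [pbound], and printing the instance nests two, even when [d = 0]. *)
Definition inp : X := ord0.
Definition vS : X := inord 1.
Definition vN : X := inord 2.
Definition ly (i : nat) : X := inord (3 + i).
Definition out : X := ord_max.

Definition genv (n : nat) : {ffun X -> nat} :=
  [ffun x => if x == inp then n else if x == vS then pbound c d n
             else if x == vN then pbound c d n + n else 0].

Definition loops : pred X := fun x => 2 < x < d + 5.

Lemma val_vS : vS = 1 :> nat. Proof. by rewrite inordK //; lia. Qed.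
Lemma val_vN : vN = 2 :> nat. Proof. by rewrite inordK //; lia. Qed.
Lemma val_ly i : i < d + 2 -> ly i = 3 + i :> nat.
Proof. by move=> lt; rewrite inordK //; lia. Qed.

Lemma neq_val (x y : X) : x != y :> nat -> x != y.
Proof. by apply: contraNneq => ->. Qed.

Lemma inp_neq : [/\ inp != out, inp != vS & inp != vN].
Proof. by split; apply: neq_val; rewrite ?val_vS ?val_vN //=; lia. Qed.

Lemma out_neq : out != vS /\ out != vN.
Proof. by split; apply: neq_val; rewrite ?val_vS ?val_vN /=; lia. Qed.

Lemma vS_neq_vN : vS != vN.
Proof. by apply: neq_val; rewrite val_vS val_vN. Qed.

Lemma source_cases (x : X) : x <= 2 -> [|| x == inp, x == vS | x == vN].
Proof. by move=> x2; rewrite -!val_eqE /= val_vS val_vN; lia. Qed.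

Lemma source_loops (x : X) : x <= 2 -> ~~ loops x.
Proof. by move=> x2; rewrite /loops; lia. Qed.

Lemma out_source : ~~ (out <= 2).
Proof. by rewrite /=; lia. Qed.

Lemma out_loops : ~~ loops out.
Proof. by rewrite /loops /=; lia. Qed.

Fixpoint gnest (k : nat) (g : gen X) : gen X :=
  if k is k'.+1 then GFor inp (ly k') (gnest k' g) else g.

Lemma gwf_gnest (isrc : pred X) k bs w : isrc inp -> k <= d ->
  (forall i, i < k -> ly i \notin bs) -> gwf isrc loops bs (gnest k (GEmit X w)).
Proof.
move=> hi; elim: k bs => //= k IH bs lt hb; rewrite hi hb //=.
rewrite /loops val_ly; last lia.
have -> : (2 < 3 + k < d + 5) by lia.
apply: IH => [|i ik]; first lia.
rewrite inE negb_or hb ?andbT; last lia.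
by apply: neq_val; rewrite !val_ly; lia.
Qed.

Lemma geval_gnest k (e : {ffun X -> nat}) : k <= d ->
  geval e (gnest k (GEmit X (nseq c true))) = nseq (c * e inp ^ k) true.
Proof.
elim: k e => [|k IH] e lt /=; first by rewrite muln1.
have -> : [seq geval (upd e (ly k) i) (gnest k (GEmit X (nseq c true)))
           | i <- iota 0 (e inp)] = [seq nseq (c * e inp ^ k) true | i <- iota 0 (e inp)].
  apply: eq_map => i; rewrite IH ?upd_neq //; last lia.
  by apply: neq_val; rewrite val_ly /=; lia.
by rewrite expnS mulnCA flatten_nseq_iota.
Qed.

Variables (h r0 r1 : seq bool) (g : gen X).
Hypothesis wfg : gwf [pred x : X | x <= 2] loops [::] g.

Definition gfun (w : seq bool) : seq bool :=
  h ++ flatten [seq if b then r1 else r0 | b <- w] ++ geval (genv (size w)) g.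

Definition gS : gen X := GCat (gnest d (GEmit X (nseq c true))) (GEmit X (nseq c true)).
Definition gN : gen X := GCat gS (GFor inp (ly 0) (GEmit X [:: true])).

(** Scanning the letters leaves the head past the end of the input, which from then on is a source
    for loops; [vS] and [vN] become sources once printed. *)
Definition gprog : comp X :=
  Seq (cemit out h)
  (Seq (While inp isSome
         (Seq (If inp (pred1 (Some true)) (cemit out r1) (cemit out r0)) (mv inp MoveR)))
  (Seq (cgen vS gS)
  (Seq (cgen vN gN)
  (Seq (cgen out g) (rewind out))))).

Lemma exec_bits (T : {ffun X -> ctp}) w l :
  T inp = ([::], map Some w) -> T out = (l, [::]) ->
  exec (While inp isSome
         (Seq (If inp (pred1 (Some true)) (cemit out r1) (cemit out r0)) (mv inp MoveR)))
    T (size w * (size r0 + size r1 + 4)).+1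
    (upd (upd T inp (map Some (rev w), [::])) out
         (catrev (map Some (flatten [seq if b then r1 else r0 | b <- w])) l, [::])).
Proof.
move=> ei eo.
have [io _ _] := inp_neq.
have oi : out != inp by rewrite eq_sym.
pose F k := upd (upd T inp (map Some (catrev (take k w) [::]), map Some (drop k w))) out
         (catrev (map Some (flatten [seq if b then r1 else r0 | b <- take k w])) l, [::]).
have -> : T = F 0 by rewrite /F take0 drop0 /= -ei upd_id -eo upd_id.
have -> : upd (upd (F 0) inp (map Some (rev w), [::])) out
         (catrev (map Some (flatten [seq if b then r1 else r0 | b <- w])) l, [::]) =
         F (size w).
  rewrite /F take_size drop_size catrevE cats0.
  by rewrite (updC _ _ _ oi) !upd_upd.
apply: exec_le (exec_While_iter (F := F) (c := size r0 + size r1 + 3) _ _ _) _ => [k lt||k lt|].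
- by rewrite /F upd_neq // upd_eq (drop_nth false lt).
- by rewrite /F upd_neq // upd_eq drop_size.
- have hI : exec (If inp (pred1 (Some true)) (cemit out r1) (cemit out r0)) (F k)
      (size r0 + size r1 + 2) (upd (F k) out (catrev (map Some (flatten
        [seq if b then r1 else r0 | b <- take k.+1 w])) l, [::])).
    have -> : size r0 + size r1 + 2 = (size r0 + size r1 + 1).+1 by lia.
    apply: exec_If.
    rewrite /cread {1}/F upd_neq // upd_eq (drop_nth false lt) /=.
    rewrite (take_nth false lt) map_rcons flatten_rcons map_cat catrev_catl.
    by case: (nth false w k) => /=; apply: exec_le (exec_cemit _ (upd_eq _ _ _)) _; lia.
  have -> : size r0 + size r1 + 3 = (size r0 + size r1 + 2) + 1 by lia.
  apply: exec_Seq hI _; apply: exec_mv_to.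
  rewrite (upd_neq _ _ io) /F (upd_neq _ _ io) upd_eq cwrite_read.
  rewrite !upd_upd (updC _ _ _ oi) upd_upd; congr (upd (upd _ _ _) _ _).
  rewrite (drop_nth false lt) (take_nth false lt) !catrevE !cats0 rev_rcons.
  by [].
- by rewrite -addnS.
Qed.

Lemma geval_gS n : geval (genv n) gS = nseq (pbound c d n) true.
Proof. by rewrite /= geval_gnest // ffunE eqxx -nseqD. Qed.

Lemma geval_gN n : geval (genv n) gN = nseq (pbound c d n + n) true.
Proof.
rewrite [LHS]/=; have := geval_gS n; rewrite /= => ->.
by rewrite (flatten_nseq_iota true 1) ffunE eqxx muln1 -nseqD.
Qed.

(** A tape being printed cannot be a source, so only the input is one while [vS] and [vN] are
    written. *)
Lemma gwf_gS : gwf (pred1 inp) loops [::] gS.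
Proof. by rewrite /= gwf_gnest //= eqxx. Qed.

Lemma gwf_gN : gwf (pred1 inp) loops [::] gN.
Proof.
have := gwf_gS; rewrite /= => ->; rewrite /loops val_ly ?addn2 //=; lia.
Qed.

Definition gtime (n : nat) : nat :=
  let B := pbound c d n + n in
  (size h).+1 + ((n * (size r0 + size r1 + 4)).+1 + (gcost B gS + (gcost B gN +
  (gcost B g + (2 * (size h + n * (size r0 + size r1) + gcost B g) + 3))))).

Lemma size_gfun w :
  size (gfun w) <= size h + size w * (size r0 + size r1) +
                   gcost (pbound c d (size w) + size w) g.
Proof.
rewrite /gfun !size_cat addnA; apply: leq_add; last first.
  by apply: size_geval => x; rewrite ffunE; repeat (case: ifP => _); lia.
rewrite leq_add2l; elim: w => // b w IH.
by rewrite /= size_cat mulSn; apply: leq_add => //; case: b; lia.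
Qed.

Lemma exec_gprog w :
  exists2 T, exec gprog [ffun i => if i == ord0 then ([::], map Some w) else ([::], [::])]
               (gtime (size w)) T
           & T out = ([::], map Some (gfun w)).
Proof.
set n := size w; set T0 := (X in exec _ X); pose e := genv n.
pose B := pbound c d n + n.
have nB : n <= B := leq_addl _ _.
have SB : pbound c d n <= B := leq_addr _ _.
have [io iS iN] := inp_neq; have [oS oN] := out_neq; have SN := vS_neq_vN.
have oi : out != inp by rewrite eq_sym.
have Si : vS != inp by rewrite eq_sym.
have So : vS != out by rewrite eq_sym.
have Ni : vN != inp by rewrite eq_sym.
have No : vN != out by rewrite eq_sym.
have NS : vN != vS by rewrite eq_sym.
have oloop := out_loops.
have iloop : ~~ loops inp := source_loops (isT : inp <= 2).
have Sloop : ~~ loops vS by apply: source_loops; rewrite val_vS.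
have Nloop : ~~ loops vN by apply: source_loops; rewrite val_vN.
have neql x y : loops x -> ~~ loops y -> x != y.
  by move=> hx; apply: contraNneq => <-.
have ei : e inp = n by rewrite ffunE eqxx.
have eS : e vS = pbound c d n by rewrite ffunE (negPf Si) eqxx.
have eN : e vN = B by rewrite ffunE (negPf Ni) (negPf NS) eqxx.
pose T1 := upd T0 out (catrev (map Some h) [::], [::]).
have h1 : exec (cemit out h) T0 (size h).+1 T1.
  by apply: exec_cemit; rewrite ffunE; case: eqP => // /eqP; rewrite (negPf oi).
pose L := catrev (map Some (flatten [seq if b then r1 else r0 | b <- w]))
                 (catrev (map Some h) [::]).
pose T2 := upd (upd T1 inp (map Some (rev w), [::])) out (L, [::]).
have h2 := @exec_bits T1 w (catrev (map Some h) [::]).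
rewrite -/L -/T2 in h2.
have {}h2 := h2 (etrans (upd_neq _ _ io) _) (upd_eq _ _ _).
have {}h2 := h2 ltac:(by rewrite ffunE).
have T2i : T2 inp = (map Some (rev w), [::]) by rewrite upd_neq // upd_eq.
have T2o : T2 out = (L, [::]) by rewrite upd_eq.
have T2x x : x != inp -> x != out -> T2 x = ([::], [::]).
  by move=> xi xo; rewrite !upd_neq // ffunE; case: eqP => // ex; rewrite ex eqxx in xi.
pose T3 := upd T2 vS (catrev (map Some (geval e gS)) [::], [::]).
have h3 : exec (cgen vS gS) T2 (gcost B gS) T3.
  apply: (@exec_cgen _ (pred1 inp) loops _ _ _ _ _ _ _ [::]) (T2x _ Si So) => //.
  - by move=> x /eqP ->.
  - exact: gwf_gS.
  split=> [x /eqP->|//|x hx _]; last by apply: T2x; apply: neql.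
  by rewrite ei T2i; split=> //; exists (rev w); rewrite ?size_rev.
pose T4 := upd T3 vN (catrev (map Some (geval e gN)) [::], [::]).
have h4 : exec (cgen vN gN) T3 (gcost B gN) T4.
  apply: (@exec_cgen _ (pred1 inp) loops _ _ _ _ _ _ _ [::]) => //.
  - by move=> x /eqP ->.
  - exact: gwf_gN.
  - split=> [x /eqP->|//|x hx _].
      by rewrite ei upd_neq // T2i; split=> //; exists (rev w); rewrite ?size_rev.
    by rewrite upd_neq ?T2x //; apply: neql.
  by rewrite upd_neq // T2x.
pose T5 := upd T4 out (catrev (map Some (geval e g)) L, [::]).
have h5 : exec (cgen out g) T4 (gcost B g) T5.
  apply: (@exec_cgen _ _ _ _ out_source out_loops source_loops g B e [::] T4 L wfg);
    last by rewrite (upd_neq _ _ oN) (upd_neq _ _ oS).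
  split=> [x /= x2|//|x hx _]; last first.
    rewrite (upd_neq _ _ (neql _ _ hx Nloop)) (upd_neq _ _ (neql _ _ hx Sloop)).
    exact: T2x (neql _ _ hx iloop) (neql _ _ hx oloop).
    case/or3P: (source_cases x2) => /eqP ->.
    + rewrite ei (upd_neq _ _ iN) (upd_neq _ _ iS) T2i; split=> //.
      by exists (rev w); rewrite ?size_rev.
    + rewrite eS (upd_neq _ _ SN) upd_eq; split=> //.
      exists (rev (geval e gS)); first by rewrite catrevE cats0 map_rev.
      by rewrite size_rev geval_gS size_nseq.
    + rewrite eN upd_eq; split=> //.
      exists (rev (geval e gN)); first by rewrite catrevE cats0 map_rev.
      by rewrite size_rev geval_gN size_nseq.
have T5o : T5 out = (map Some (rev (gfun w)), [::]).
  by rewrite upd_eq /L -!catrev_catl -!map_cat catrevE cats0 map_rev.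
have := exec_Seq h1 (exec_Seq h2 (exec_Seq h3 (exec_Seq h4
          (exec_Seq h5 (exec_rewind T5o))))).
rewrite revK => hh.
exists (upd T5 out ([::], map Some (gfun w))); last by rewrite upd_eq.
apply: exec_le hh _; rewrite /gtime -/n -/B !leq_add2l leq_add2r leq_mul2l size_rev.
exact: size_gfun.
Qed.

Lemma polyb_gtime : polyb gtime.
Proof.
have pB : polyb (fun n => pbound c d n + n).
  exact: polyb_add (polyb_pbound _ _) polyb_id.
have pc (g' : gen X) : polyb (fun n => gcost (pbound c d n + n) g').
  exact: polyb_comp (polyb_gcost g') pB.
have pl k : polyb (fun n => n * k) by apply: polyb_mul polyb_id (polyb_const _).
apply: polyb_add (polyb_const _) _; apply: polyb_add.
  apply: polyb_le (polyb_add (polyb_const 1) (pl (size r0 + size r1 + 4))) => n.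
  by rewrite add1n.
apply: polyb_add (pc _) (polyb_add (pc _) (polyb_add (pc _) _)).
apply: polyb_add (polyb_const 3); apply: polyb_mul (polyb_const 2) _.
exact: polyb_add (polyb_add (polyb_const _) (pl _)) (pc _).
Qed.

Lemma polytime_gfun : polytime gfun.
Proof.
have [c' [d' hb]] := polyb_dominated polyb_gtime.
exists (to_machine gprog), c', d' => w.
have [T hT oT] := exec_gprog w.
have [hh ht] := run_exec (exec_le hT (hb _)).
split; first exact: hh.
move: (ht out); rewrite oT /canon /out.
set t := ctape _ _ => -[el er]; split.
  by have [m em] := trim_pad (tleft t); exists m; rewrite em el.
by have [m em] := trim_pad (tright t); exists m; rewrite em er.
Qed.

End GeneratedFunctions.

(** * Straight-line code with untyped inputs *)

(** The type of genuine gates depends on the dimension, hence on the input word. Raw addresses allow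
    one fixed prologue and block for all words; [R] is [nat], or pairs for numbers affine in the
    block index. *)
Inductive rgate (R : Type) :=
| RInput of R
| RConst of rat
| RAdd of R & R
| RMul of R & R.
Arguments RConst {R}.

Definition rmap (R S : Type) (f : R -> S) (g : rgate R) : rgate S :=
  match g with
  | RInput i => RInput (f i)
  | RConst q => RConst q
  | RAdd a b => RAdd (f a) (f b)
  | RMul a b => RMul (f a) (f b)
  end.

Definition cook (k : nat) (g : rgate nat) : gate rat k.+1 :=
  match g with
  | RInput i => Input (inord i)
  | RConst q => Const q
  | RAdd a b => Add a b
  | RMul a b => Mul a b
  end.

Definition rok (p : nat) (g : rgate nat) : bool :=
  match g with RAdd a b | RMul a b => (a < p) && (b < p) | _ => true end.

Definition rval (v gv : nat -> rat) (g : rgate nat) : rat :=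
  match g with
  | RInput i => v i
  | RConst q => q
  | RAdd a b => (gv a + gv b)%R
  | RMul a b => (gv a * gv b)%R
  end.

(** Gates refer to absolute positions, so every statement about a piece of code carries the position
    [b] where it starts. *)
Definition gall (P : nat -> rgate nat -> Prop) (b : nat) (gs : seq (rgate nat)) : Prop :=
  forall i, i < size gs -> P (b + i) (nth (RConst 0%R) gs i).

Definition wfgates := gall rok.

Definition sat (v gv : nat -> rat) := gall (fun p g => gv p = rval v gv g).

Definition inputs (gs : seq (rgate nat)) : seq nat :=
  pmap (fun g => if g is RInput i then Some i else None) gs.

Lemma inputs_cat gs hs : inputs (gs ++ hs) = inputs gs ++ inputs hs.
Proof. exact: pmap_cat. Qed.

Lemma inputs_flatten ss : inputs (flatten ss) = flatten (map inputs ss).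
Proof. by elim: ss => //= s ss IH; rewrite inputs_cat IH. Qed.

Lemma inputs_Input s : inputs (map (@RInput nat) s) = s.
Proof. by elim: s => //= i s ->. Qed.

Lemma gall1 P b g : gall P b [:: g] <-> P b g.
Proof.
split=> [/(_ 0 isT)|h [|//] _]; first by rewrite addn0.
by rewrite addn0.
Qed.

Lemma gall_cat P b gs hs :
  gall P b (gs ++ hs) <-> gall P b gs /\ gall P (b + size gs) hs.
Proof.
split=> [h|[h1 h2] i].
  split=> i lt.
    by have := h i; rewrite size_cat nth_cat lt; apply; lia.
  have := h (size gs + i); rewrite size_cat nth_cat ltn_add2l addnA.
  by rewrite (ltnNge (_ + i)) leq_addr addKn; apply.
rewrite size_cat nth_cat; case: (ltnP i (size gs)) => [lt _|ge lt]; first exact: h1.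
by have := h2 (i - size gs); rewrite -addnA subnKC //; apply; lia.
Qed.

Lemma gall_cons P b g gs : gall P b (g :: gs) <-> P b g /\ gall P b.+1 gs.
Proof. by rewrite -cat1s gall_cat gall1 addn1. Qed.

Lemma gall_map P b (f : nat -> rgate nat) n :
  gall P b (map f (iota 0 n)) <-> forall i, i < n -> P (b + i) (f i).
Proof.
rewrite /gall size_map size_iota; split=> h i lt; have := h i lt;
  by rewrite (nth_map 0) ?size_iota ?nth_iota.
Qed.

Section UniformBlocks.
Variables (A : Type) (blk : nat -> seq A) (s N : nat).
Hypothesis size_blk : forall i, i < N -> size (blk i) = s.

Lemma size_blocks : size (flatten (map blk (iota 0 N))) = s * N.
Proof.
elim: N size_blk => [|n IH] hs; first by rewrite muln0.
rewrite -[n.+1]addn1 iotaD map_cat flatten_cat size_cat IH; last by move=> i lt; apply: hs; lia.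
by rewrite /= cats0 hs // addn1 mulnS addnC.
Qed.

End UniformBlocks.

Lemma nth_blocks (A : Type) (x0 : A) (blk : nat -> seq A) s N i r :
  (forall i, i < N -> size (blk i) = s) -> i < N -> r < s ->
  nth x0 (flatten (map blk (iota 0 N))) (s * i + r) = nth x0 (blk i) r.
Proof.
elim: N => // n IH hs ltn ltr.
have hs' j : j < n -> size (blk j) = s by move=> lt; apply: hs; lia.
rewrite -[n.+1]addn1 iotaD map_cat flatten_cat nth_cat (size_blocks hs') /= cats0.
case: (ltngtP i n) => [lt|gt|->].
- have -> : s * i + r < s * n by nia.
  exact: IH.
- lia.
have -> : (s * n + r < s * n) = false by lia.
by rewrite addKn.
Qed.

Lemma gall_blocks P b (blk : nat -> seq (rgate nat)) s N :
  (forall i, i < N -> size (blk i) = s) ->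
  gall P b (flatten (map blk (iota 0 N))) <->
  (forall i, i < N -> gall P (b + s * i) (blk i)).
Proof.
elim: N => [|n IH] hs; first by split.
have hs' j : j < n -> size (blk j) = s by move=> lt; apply: hs; lia.
rewrite -[n.+1]addn1 iotaD map_cat flatten_cat gall_cat IH // (size_blocks hs') /= cats0.
split=> [[h1 h2] i lt|h].
  by case: (ltngtP i n) => [lt'|gt|->] //; [exact: h1 | lia].
by split=> [i lt|]; apply: h; lia.
Qed.

Lemma rval_ext v gv gv' p g : rok p g -> (forall j, j < p -> gv j = gv' j) ->
  rval v gv g = rval v gv' g.
Proof. by case: g => //= a b /andP[ap bp] h; rewrite !h. Qed.

(** * Circuits obtained from untyped code *)

Section CookedCircuits.
Local Open Scope ring_scope.
Variable k : nat.

Definition cpolys (gs : seq (rgate nat)) : seq {mpoly rat[k.+1]} :=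
  gate_polys (map (@cook k) gs).

Lemma cpolys_rcons gs g :
  cpolys (rcons gs g) = rcons (cpolys gs) (gate_poly (cpolys gs) (cook k g)).
Proof. by rewrite /cpolys map_rcons /gate_polys foldl_rcons. Qed.

Lemma size_cpolys gs : size (cpolys gs) = size gs.
Proof. by elim/last_ind: gs => // gs g IH; rewrite cpolys_rcons !size_rcons IH. Qed.

(** The bridge from polynomials to numbers: the values of the gate polynomials satisfy the local
    gate equations, and the simulation reasons on these equations only. *)
Lemma sat_cpolys gs (v : 'I_k.+1 -> rat) : wfgates 0 gs ->
  sat (fun i => v (inord i)) (fun p => ((cpolys gs)`_p).@[v]) 0 gs.
Proof.
elim/last_ind: gs => [//|gs g IH]; rewrite -cats1 => /gall_cat [wgs /gall1 wg].
have nthE j : (j < size gs)%N -> ((cpolys (gs ++ [:: g]))`_j).@[v] = ((cpolys gs)`_j).@[v].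
  by move=> lt; rewrite cats1 cpolys_rcons nth_rcons size_cpolys lt.
apply/gall_cat; split.
  move=> i lt; rewrite add0n nthE //; have := IH wgs i lt; rewrite add0n => ->.
  apply: rval_ext (wgs _ lt) _ => j ltj; rewrite nthE //.
  by apply: ltn_trans ltj _; rewrite add0n.
apply/gall1; rewrite add0n cats1 cpolys_rcons nth_rcons size_cpolys ltnn eqxx.
rewrite -cpolys_rcons -cats1; rewrite add0n in wg.
case: g wg nthE => [i|q|a b|a b] /=; rewrite ?mevalXU ?mevalC //.
  by case/andP=> ha hb nthE; rewrite mevalD !nthE.
by case/andP=> ha hb nthE; rewrite mevalM !nthE.
Qed.

Variables (gs : seq (rgate nat)) (o : nat).
Hypothesis wf : wfgates 0 gs.
Hypothesis ins : inputs gs = iota 0 k.+1.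

Definition ccircuit : circuit rat k.+1 := Circuit (map (@cook k) gs) [:: o].

Lemma ccircuit_ok : (o < size gs)%N -> circuit_ok ccircuit.
Proof.
move=> lt; rewrite /circuit_ok /= size_map lt; apply/and3P; split=> //.
  move: wf; rewrite /wfgates; elim: gs (0%N) => //= g hs IH b /gall_cons [wg whs].
  by rewrite IH // andbT; case: g wg.
apply/forallP=> i; rewrite count_map.
have -> : count (preim (@cook k) (labelled_with i)) gs =
          count (fun j => i == inord j) (inputs gs).
  by elim: gs => //= -[j|q|a b|a b] hs IH //=; rewrite IH.
rewrite ins (@eq_in_count _ _ (pred1 (val i))).
  by rewrite count_uniq_mem ?iota_uniq // mem_iota add0n ltn_ord.
move=> j; rewrite mem_iota add0n => ltj /=.
by rewrite -val_eqE /= inordK // eq_sym.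
Qed.

Lemma ccircuit_represents : (o < size gs)%N -> represents ccircuit (cpolys gs)`_o.
Proof. by move=> lt; split=> //; apply: ccircuit_ok. Qed.

Lemma represents_ccircuit P : represents ccircuit P -> P = (cpolys gs)`_o.
Proof. by move=> [_ []]. Qed.

End CookedCircuits.

(** * Functions computed by code, and interpolation *)

Section Codable.
Local Open Scope ring_scope.

(* The code may be placed anywhere after [b], so that codes can be chained. *)
Definition codable (b : nat) (f : (nat -> rat) -> rat) : Prop :=
  forall b', (b <= b')%N -> exists gs p,
    [/\ wfgates b' gs, inputs gs = [::], (p < b' + size gs)%N
      & forall v gv, sat v gv b' gs -> gv p = f gv].

Lemma codable_eq b f g : (forall gv, f gv = g gv) -> codable b f -> codable b g.
Proof.
move=> fg h b' le; have [gs [p [h1 h2 h3 h4]]] := h b' le.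
by exists gs, p; split=> // v gv /h4 ->.
Qed.

Lemma codable_const b q : codable b (fun=> q).
Proof.
move=> b' _; exists [:: RConst q], b'; split=> //=; first exact/gall1.
- by rewrite addn1.
by move=> v gv /gall1.
Qed.

Lemma codable_ref b p : (p < b)%N -> codable b (fun gv => gv p).
Proof.
by move=> pb b' le; exists [::], p; split=> //=; rewrite addn0; apply: leq_trans le.
Qed.

Lemma codable_op b f g (G : nat -> nat -> rgate nat) (F : rat -> rat -> rat) :
  (forall p a c, rok p (G a c) = (a < p)%N && (c < p)%N) ->
  (forall a c, inputs [:: G a c] = [::]) ->
  (forall v gv a c, rval v gv (G a c) = F (gv a) (gv c)) ->
  codable b f -> codable b g -> codable b (fun gv => F (f gv) (g gv)).
Proof.
move=> G1 G2 G3 hf hg b' le.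
have [fs [p [f1 f2 f3 f4]]] := hf b' le.
have [gs [q [g1 g2 g3 g4]]] := hg (b' + size fs)%N (leq_trans le (leq_addr _ _)).
exists (fs ++ gs ++ [:: G p q]), (b' + size fs + size gs)%N; split.
- apply/gall_cat; split=> //; apply/gall_cat; split=> //; apply/gall1.
  by rewrite G1 g3 andbT; apply: leq_trans f3 (leq_addr _ _).
- by rewrite !inputs_cat f2 g2 G2.
- by rewrite !size_cat /=; lia.
move=> v gv /gall_cat [s1 /gall_cat [s2 /gall1 ->]].
by rewrite G3 (f4 _ _ s1) (g4 _ _ s2).
Qed.

Lemma codable_add b f g :
  codable b f -> codable b g -> codable b (fun gv => f gv + g gv).
Proof. exact: (@codable_op b f g (@RAdd nat) +%R). Qed.

Lemma codable_mul b f g :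
  codable b f -> codable b g -> codable b (fun gv => f gv * g gv).
Proof. exact: (@codable_op b f g (@RMul nat) *%R). Qed.

Lemma codable_sum b (I : Type) (r : seq I) (f : I -> (nat -> rat) -> rat) :
  (forall i, codable b (f i)) -> codable b (fun gv => \sum_(i <- r) f i gv).
Proof.
move=> h; elim: r => [|i r IH].
  by apply: codable_eq _ (@codable_const b 0) => gv; rewrite big_nil.
by apply: codable_eq _ (codable_add (h i) IH) => gv; rewrite big_cons.
Qed.

Lemma codable_prod b (I : Type) (r : seq I) (f : I -> (nat -> rat) -> rat) :
  (forall i, codable b (f i)) -> codable b (fun gv => \prod_(i <- r) f i gv).
Proof.
move=> h; elim: r => [|i r IH].
  by apply: codable_eq _ (@codable_const b 1) => gv; rewrite big_nil.
by apply: codable_eq _ (codable_mul (h i) IH) => gv; rewrite big_cons.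
Qed.

Lemma codable_family (K : finType) b (f : K -> (nat -> rat) -> rat) :
  (forall i, codable b (f i)) -> exists gs (pos : K -> nat),
    [/\ wfgates b gs, inputs gs = [::], forall i, (pos i < b + size gs)%N
      & forall v gv, sat v gv b gs -> forall i, gv (pos i) = f i gv].
Proof.
move=> h.
suff [gs [pos [h1 h2 h3 h4]]] : exists gs (pos : K -> nat),
    [/\ wfgates b gs, inputs gs = [::],
        forall i, i \in enum K -> (pos i < b + size gs)%N
      & forall v gv, sat v gv b gs -> forall i, i \in enum K -> gv (pos i) = f i gv].
  exists gs, pos; split=> // [i|v gv s i]; first by rewrite h3 ?mem_enum.
  by rewrite (h4 _ _ s) ?mem_enum.
elim: (enum K) => [|i s [gs [pos [h1 h2 h3 h4]]]].
  by exists [::], (fun=> 0%N); split.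
have [hs [p [g1 g2 g3 g4]]] := h i (b + size gs)%N (leq_addr _ _).
exists (gs ++ hs), (fun j => if j == i then p else pos j); split.
- exact/gall_cat.
- by rewrite inputs_cat h2 g2.
- move=> j; rewrite inE size_cat addnA; case: eqP => //= _ /h3 lt.
  exact: leq_trans lt (leq_addr _ _).
move=> v gv /gall_cat [s1 s2] j; rewrite inE; case: eqP => [-> _|_ /=].
  exact: g4 s2.
exact: h4 s1 _.
Qed.

Definition lagrange (D : finType) (code : D -> rat) (d : D) (x : rat) : rat :=
  \prod_(d' <- enum D | d' != d) ((x - code d') / (code d - code d')).

Lemma lagrangeE (D : finType) (code : D -> rat) d d' : injective code ->
  lagrange code d (code d') = (d' == d)%:R.
Proof.
move=> inj; rewrite /lagrange; case: (eqVneq d' d) => [->|ne].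
  rewrite big1_seq // => x /andP[xd _]; rewrite divff // subr_eq0.
  by rewrite (inj_eq inj) eq_sym.
rewrite big_mkcond (bigD1_seq d') ?mem_enum ?enum_uniq //= ne.
by rewrite subrr !mul0r.
Qed.

Lemma codable_lagrange b (D : finType) (code : D -> rat) d f :
  codable b f -> codable b (fun gv => lagrange code d (f gv)).
Proof.
move=> hf.
pose F d' gv := if d' != d then (f gv + - code d') * (code d - code d')^-1 else 1.
apply: (@codable_eq _ (fun gv => \prod_(d' <- enum D) F d' gv)).
  by move=> gv; rewrite /lagrange [RHS]big_mkcond.
apply: codable_prod => d'; rewrite /F; case: (d' != d); last exact: (@codable_const b 1).
exact: codable_mul (codable_add hf (codable_const _)) (codable_const _).
Qed.

End Codable.

(** * The polynomially recursive simulation *)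

Section Simulation.
Local Open Scope ring_scope.
Variable M : machine.

(** Locked, so that simplification does not split a successor off the number of tapes in the index
    arithmetic. *)
Definition nT : nat := locked (tapes M).+1.

Lemma nTE : nT = (tapes M).+1. Proof. by rewrite /nT -lock. Qed.

Lemma ltn_nT (j : 'I_(tapes M).+1) : (j < nT)%N. Proof. by rewrite nTE. Qed.

Notation tp := 'I_(tapes M).+1.
Notation St := (option (state M)).
Notation reading := {ffun 'I_(tapes M).+1 -> symbol M}.

Definition cq (o : St) : rat := (enum_rank o)%:R.
Definition cs (a : symbol M) : rat := (enum_rank a)%:R.

Lemma cq_inj : injective cq.
Proof.
move=> x y /eqP; rewrite /cq eqr_nat => /eqP h.
by apply: enum_rank_inj; apply: val_inj.
Qed.

Lemma cs_inj : injective cs.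
Proof.
move=> x y /eqP; rewrite /cs eqr_nat => /eqP h.
by apply: enum_rank_inj; apply: val_inj.
Qed.

(* The additional state [None] moves the head of the first tape from the blank
   cell before the input to the first letter of the input. *)
Definition dstep (o : St) (r : reading) :
    St * {ffun 'I_(tapes M).+1 -> symbol M * move} :=
  match o with
  | None => (Some (start M), [ffun j => (r j, if j == ord0 then MoveR else Stay)])
  | Some q => if halting q then (Some q, [ffun j => (r j, Stay)])
              else let d := delta q r in (Some d.1, d.2)
  end.

Definition accq (o : St) : bool :=
  if o is Some q then halting q && accepting q else false.

(** Built from [option], products and [bool], so that it is a finite type at once and
    [codable_family] applies. *)
Definition ctl := (option bool + 'I_(tapes M).+1 * (bool * bool))%type.

Definition kBlank : ctl := inl None.
Definition kObs : ctl := inl (Some false).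
Definition kState : ctl := inl (Some true).
Definition kWrite (j : tp) : ctl := inr (j, (true, true)).
Definition kRight (j : tp) : ctl := inr (j, (true, false)).
Definition kLeft (j : tp) : ctl := inr (j, (false, true)).
Definition kStay (j : tp) : ctl := inr (j, (false, false)).

Definition ctl_val (k : ctl) (o : St) (r : reading) : rat :=
  match k with
  | inl None => cs (blank M)
  | inl (Some false) => 1 - (accq o)%:R
  | inl (Some true) => cq (dstep o r).1
  | inr (j, (true, true)) => cs ((dstep o r).2 j).1
  | inr (j, (true, false)) => if ((dstep o r).2 j).2 is MoveR then 1 else 0
  | inr (j, (false, true)) => if ((dstep o r).2 j).2 is MoveL then 1 else 0
  | inr (j, (false, false)) => if ((dstep o r).2 j).2 is Stay then 1 else 0
  end.

(** The pairs of a state and a reading form a finite set fixed by [M], so this code does not depend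
    on the input word. *)
Lemma control_exists : exists gs (pos : ctl -> nat),
  [/\ wfgates (nT + 2) gs, inputs gs = [::], forall k, (pos k < nT + 2 + size gs)%N
    & forall v gv o (r : reading), sat v gv (nT + 2) gs -> gv 1%N = cq o ->
      (forall j : tp, gv (j + 2)%N = cs (r j)) ->
      forall k, gv (pos k) = ctl_val k o r].
Proof.
pose D : finType := (St * reading)%type.
(* A product of Lagrange basis polynomials: at codes of an actual state and reading it is the
   indicator of [d], so that [f] below picks the right entry of the table [ctl_val]. *)
pose W (d : D) (gv : nat -> rat) := lagrange cq d.1 (gv 1%N) *
  \prod_(j <- enum tp) lagrange cs (d.2 j) (gv (j + 2)%N).
pose f k gv := \sum_(d <- enum D) (ctl_val k d.1 d.2 * W d gv).
have [k|gs [pos [h1 h2 h3 h4]]] := @codable_family ctl (nT + 2) f.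
  apply: codable_sum => d; apply: codable_mul (codable_const _) _.
  apply: codable_mul; first by apply: codable_lagrange; apply: codable_ref; rewrite addn2.
  apply: codable_prod => j; apply: codable_lagrange; apply: codable_ref.
  by rewrite ltn_add2r ltn_nT.
exists gs, pos; split=> // v gv o r /h4 h eo er k; rewrite {}h /f.
have WE d : W d gv = (d == (o, r))%:R.
  rewrite /W eo (lagrangeE _ _ cq_inj).
  under eq_bigr do rewrite er (lagrangeE _ _ cs_inj).
  case: d => o' r'; rewrite xpair_eqE /= (eq_sym o'); case: (o == o') => /=; last by rewrite mul0r.
  rewrite mul1r; case: (eqVneq r' r) => [->|ne]; first by rewrite big1 // => j _; rewrite eqxx.
  have /existsP[j rj] : [exists j, r j != r' j].
    rewrite -negb_forall; apply: contraNN ne => /forallP h; apply/eqP/ffunP=> j.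
    by have /eqP := h j.
  by rewrite (bigD1_seq j) ?mem_enum ?enum_uniq //= (negPf rj) mul0r.
rewrite (bigD1_seq (o, r)) ?mem_enum ?enum_uniq //= WE eqxx mulr1.
by rewrite big1 ?addr0 // => d ne; rewrite WE (negPf ne) mulr0.
Qed.

(** * Layout of the gates *)

Definition aff := (nat * nat)%type.
Definition aval (i : nat) (x : aff) : nat := (x.1 * i + x.2)%N.

(* The last gate is the output, and [b t] is the position of the [t]-th gate. *)
Definition combine (R : Type) (b : nat -> R) (A p B q C r : R) : seq (rgate R) :=
  [:: RMul A p; RMul B q; RMul C r; RAdd (b 0%N) (b 1%N); RAdd (b 3%N) (b 2%N)].

Lemma gall_combine (P : nat -> rgate nat -> Prop) b b' A p B q C r : b' = b ->
  gall P b' (combine (addn b) A p B q C r) <->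
  [/\ P b (RMul A p), P b.+1 (RMul B q), P b.+2 (RMul C r),
      P b.+3 (RAdd b b.+1) & P b.+4 (RAdd b.+3 b.+2)].
Proof.
move=> ->; rewrite /combine !gall_cons addn0 addn1 addn2 addn3; split.
  by case=> ? [? [? [? [? _]]]].
by case=> *; do !split=> //.
Qed.

Lemma gall_combines (P : nat -> rgate nat -> Prop) b c A p B q C r n :
  gall P b (flatten [seq combine (addn (c + 5 * l)) (A l) (p l) (B l) (q l) (C l) (r l)
                    | l <- iota 0 n]) <->
  forall l, (l < n)%N -> gall P (b + 5 * l)
    (combine (addn (c + 5 * l)) (A l) (p l) (B l) (q l) (C l) (r l)).
Proof. exact: gall_blocks. Qed.

Variables (ctlgates : seq (rgate nat)) (pos : ctl -> nat).
Hypothesis ctl_wf : wfgates (nT + 2) ctlgates.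
Hypothesis ctl_inputs : inputs ctlgates = [::].
Hypothesis pos_lt : forall k, (pos k < nT + 2 + size ctlgates)%N.
Hypothesis ctl_sat : forall v gv o (r : reading),
  sat v gv (nT + 2) ctlgates -> gv 1%N = cq o ->
  (forall j : tp, gv (j + 2)%N = cs (r j)) -> forall k, gv (pos k) = ctl_val k o r.

(* There are two lanes per tape.  Lane [j < nT] holds the cells to the right of
   the head of the tape [j], and lane [nT + j] those to its left; position [0] of
   both lanes is the symbol that is written under the head. *)
Definition nL : nat := (nT + nT)%N.

Definition lane_tape (l : nat) : tp := inord (l %% nT).
Definition posW (l : nat) : nat := pos (kWrite (lane_tape l)).
(** [A] selects the neighbour farther from the head and [B] the nearer one. The farther one comes in
    on a right move for a right lane and on a left move for a left lane, so both lanes have the same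
    recurrence with the moves exchanged. *)
Definition posA (l : nat) : nat :=
  pos (if (l < nT)%N then kRight (lane_tape l) else kLeft (lane_tape l)).
Definition posB (l : nat) : nat :=
  pos (if (l < nT)%N then kLeft (lane_tape l) else kRight (lane_tape l)).
Definition posC (l : nat) : nat := pos (kStay (lane_tape l)).

(** Multiplying by this gate copies a value to another position: the written symbols are thus
    brought to position 0 of the lanes, at addresses fitting the common stride. *)
Definition one_gate : nat := (nT + 2 + size ctlgates)%N.
Definition base : nat := one_gate.+1.

Definition pad (n : nat) : seq (rgate nat) := [seq RConst 0 | _ <- iota 0 n].

(* Position [p] of lane [l] is computed by the gate [base + 6 * nL * p + l], and its
   next value by the gate [base + 6 * nL * p.+1 + nL + 5 * l + 4]; the padding keeps
   the stride [6 * nL] from the start. *)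
Definition prologue : seq (rgate nat) :=
  [seq RInput i | i <- iota 0 (nT + 2)] ++ ctlgates ++ [:: RConst 1] ++
  [seq RMul (posW l) one_gate | l <- iota 0 nL] ++ pad (5 * nL) ++
  [seq RInput (nT + 2 + l)%N | l <- iota 0 nL] ++
  flatten [seq combine (addn (base + 7 * nL + 5 * j)) (posA j) (base + 6 * nL + j)%N
                 (posB j) (base + 6 * nL + nT + j)%N (posC j) (base + j)%N
          | j <- iota 0 nT] ++
  pad (5 * nT).

(** Block [i] reads row [i.+1] of the variables and computes the next value of row [i]: a cell can
    be updated only once its outer neighbour has been read. Row 0 is read in the prologue. *)
Definition block : seq (rgate aff) :=
  [seq RInput (nL, nT + 2 + nL + l)%N | l <- iota 0 nL] ++
  flatten [seq combine (fun t => (6 * nL, base + 13 * nL + 5 * l + t)%N)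
                 (0, posA l)%N (6 * nL, base + 12 * nL + l)%N
                 (0, posB l)%N (6 * nL, base + l)%N
                 (0, posC l)%N (6 * nL, base + 6 * nL + l)%N
          | l <- iota 0 nL].

Definition all_gates (N : nat) : seq (rgate nat) :=
  prologue ++ flatten [seq [seq rmap (aval i) g | g <- block] | i <- iota 0 N].

Definition block_outs : seq aff :=
  [seq (6 * nL, base + 13 * nL + 5 * l + 4)%N | l <- iota 0 nL].

Definition head_outs : seq nat :=
  [:: pos kObs; pos kState] ++ [seq (base + 7 * nL + 5 * j + 4)%N | j <- iota 0 nT].

(** Outputs are listed in the order of the variables. The last row has no outer neighbour; its next
    value is the blank constant, which is correct under the space bound. *)
Definition all_outs (N : nat) : seq nat :=
  head_outs ++ flatten [seq [seq aval i x | x <- block_outs] | i <- iota 0 N] ++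
  nseq nL (pos kBlank).

Lemma size_combines (R : Type) n (f : nat -> seq (rgate R)) :
  (forall i, size (f i) = 5) -> size (flatten (map f (iota 0 n))) = (5 * n)%N.
Proof. by move=> hf; rewrite (@size_blocks _ f 5). Qed.

Lemma size_prologue : size prologue = (base + 12 * nL)%N.
Proof.
rewrite /prologue !size_cat !size_map !size_iota size_combines // /=.
rewrite /base /one_gate /nL; lia.
Qed.

Lemma size_block : size block = (6 * nL)%N.
Proof. rewrite /block size_cat size_map size_iota size_combines //; lia. Qed.

Lemma map_block i : [seq rmap (aval i) g | g <- block] =
  [seq RInput (nL * i + (nT + 2 + nL + l))%N | l <- iota 0 nL] ++
  flatten [seq combine (addn (base + 12 * nL + 6 * nL * i + nL + 5 * l))
                 (posA l) (base + 12 * nL + 6 * nL * i + l)%N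
                 (posB l) (base + 6 * nL * i + l)%N
                 (posC l) (base + 6 * nL + 6 * nL * i + l)%N
          | l <- iota 0 nL].
Proof.
rewrite /block map_cat -map_comp map_flatten -map_comp; congr (_ ++ flatten _).
apply: eq_map => l; rewrite /= /combine /aval /= mul0n !add0n.
by do ![congr (_ :: _)]; try congr (RMul _ _); try congr (RAdd _ _); lia.
Qed.

Lemma pos_lt_base k : (pos k < base)%N.
Proof. exact: ltnW (pos_lt k). Qed.

Lemma gall_pad (P : nat -> rgate nat -> Prop) b n :
  (forall i, P i (RConst 0)) -> gall P b (pad n).
Proof. by move=> h; apply/gall_map. Qed.

Lemma wf_all_gates N : wfgates 0 (all_gates N).
Proof.
have pl k := pos_lt_base k.
apply/gall_cat; split.
  rewrite /prologue; do ![apply/gall_cat; split]; rewrite ?size_map ?size_iota ?add0n //=.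
  - by apply/gall_map.
  - by apply/gall1.
  - apply/gall_map => i lt; rewrite /rok /posW; have := pos_lt (kWrite (lane_tape i)).
    rewrite /one_gate; lia.
  - by apply: gall_pad.
  - by apply/gall_map.
  - apply/gall_combines => j lt; apply/gall_combine.
      by rewrite /base /one_gate /nL; lia.
    have := pl (if (j < nT)%N then kRight (lane_tape j) else kLeft (lane_tape j)).
    have := pl (if (j < nT)%N then kLeft (lane_tape j) else kRight (lane_tape j)).
    have := pl (kStay (lane_tape j)).
    rewrite /rok /posA /posB /posC /base /one_gate /nL => *.
    split; lia.
  - by apply: gall_pad.
apply/(@gall_blocks _ _ _ (6 * nL)) => [i _|i lt]; first by rewrite size_map size_block.
rewrite map_block size_prologue add0n; apply/gall_cat; split; first exact/gall_map.
apply/gall_combines => l ltl.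
apply/gall_combine; first by rewrite size_map size_iota; lia.
have := pl (if (l < nT)%N then kRight (lane_tape l) else kLeft (lane_tape l)).
have := pl (if (l < nT)%N then kLeft (lane_tape l) else kRight (lane_tape l)).
have := pl (kStay (lane_tape l)).
rewrite /rok /posA /posB /posC => *; split; lia.
Qed.

(** The variables are read once each and in increasing order; this gives the bijective labelling
    demanded by [circuit_ok]. *)
Lemma inputs_all_gates N : inputs (all_gates N) = iota 0 (nT + 2 + nL * N.+1).
Proof.
have ci n (f : nat -> seq (rgate nat)) : (forall i, inputs (f i) = [::]) ->
    inputs (flatten [seq f i | i <- iota 0 n]) = [::].
  by move=> h; rewrite inputs_flatten -map_comp; elim: (iota 0 n) => //= i s ->; rewrite h.
have pad0 n : inputs (pad n) = [::] by rewrite /pad; elim: (iota 0 n).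
have mul0 f g s : inputs [seq RMul (f l) (g l) | l : nat <- s] = [::] by elim: s.
have inpE f s : inputs [seq RInput (f l) | l : nat <- s] = [seq f l | l <- s].
  by rewrite -[RHS]inputs_Input -map_comp.
have iotaE m n : [seq (m + l)%N | l <- iota 0 n] = iota m n.
  by rewrite -[in RHS](addn0 m) iotaDl.
elim: N => [|N IH].
  rewrite /all_gates /prologue cats0 !inputs_cat ctl_inputs (mul0 posW) !pad0 ci //.
  by rewrite !inpE map_id iotaE !cats0 muln1 [RHS]iotaD.
have -> : all_gates N.+1 = all_gates N ++ [seq rmap (aval N) g | g <- block].
  by rewrite /all_gates -addn1 iotaD map_cat flatten_cat /= cats0 catA.
rewrite inputs_cat IH map_block inputs_cat ci // cats0 inpE.
have -> : (nT + 2 + nL * N.+2 = nT + 2 + nL * N.+1 + nL)%N by rewrite (mulnS _ N.+1); lia.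
rewrite [RHS]iotaD add0n; congr (_ ++ _); rewrite -[RHS]iotaE; apply: eq_map => l.
rewrite mulnS; lia.
Qed.

Lemma size_all_outs N : size (all_outs N) = (nT + 2 + nL * N.+1)%N.
Proof.
rewrite /all_outs !size_cat (@size_blocks _ (fun i => map (aval i) block_outs) nL).
  by rewrite /= size_map size_iota size_nseq mulnS; lia.
by move=> i _; rewrite !size_map size_iota.
Qed.

Lemma all_outs_lt N o : o \in all_outs N -> (o < size (all_gates N))%N.
Proof.
have -> : size (all_gates N) = (base + 12 * nL + 6 * nL * N)%N.
  rewrite size_cat size_prologue (@size_blocks _ (fun i => map (rmap (aval i)) block) (6 * nL)) //.
  by move=> i _; rewrite size_map size_block.
have pl k := pos_lt_base k.
rewrite !mem_cat !inE => /or3P[/orP[/orP[]/eqP->|]||].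
- have := pl kObs; lia.
- have := pl kState; lia.
- case/mapP=> j; rewrite mem_iota /nL => /andP[_ lt] ->; lia.
- case/flattenP=> s /mapP[i]; rewrite mem_iota => /andP[_ lt] -> /mapP[x].
  case/mapP=> l; rewrite mem_iota => /andP[_ ltl] -> ->; rewrite /aval /=.
  have : (6 * nL * i + 6 * nL <= 6 * nL * N)%N by rewrite -mulnSr leq_mul2l; lia.
  lia.
by rewrite mem_nseq => /andP[_ /eqP ->]; have := pl kBlank; lia.
Qed.

(** * The gate equations, and one step of the simulation *)

Section Step.
Variables (N : nat) (v gv : nat -> rat).
Hypothesis gsat : sat v gv 0 (all_gates N).

Lemma sat_prologue : [/\ forall i, (i < nT + 2)%N -> gv i = v i,
    sat v gv (nT + 2) ctlgates,
    forall l, (l < nL)%N -> gv (base + l)%N = gv (posW l),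
    forall l, (l < nL)%N -> gv (base + 6 * nL + l)%N = v (nT + 2 + l)%N
  & forall j, (j < nT)%N -> gv (base + 7 * nL + 5 * j + 4)%N =
      gv (posA j) * gv (base + 6 * nL + j)%N +
      gv (posB j) * gv (base + 6 * nL + nT + j)%N + gv (posC j) * gv (base + j)%N].
Proof.
move: gsat => /gall_cat [+ _]; rewrite /prologue.
move=> /gall_cat [s1 /gall_cat [s2 /gall_cat [s3 /gall_cat [s4 /gall_cat [s5
       /gall_cat [s6 /gall_cat [s7 _]]]]]]].
rewrite /pad ?size_map ?size_iota ?add0n /= in s1 s2 s3 s4 s5 s6 s7.
move: s3 => /gall1 /= one.
move: s1 s4 s6 => /gall_map s1 /gall_map s4 /gall_map s6.
split=> //.
- by move=> l /s4 /=; rewrite addn1 /one_gate one mulr1.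
- move=> l /s6 /= <-; congr gv; rewrite /base /one_gate; lia.
move=> j lt; move/gall_combines: s7 => /(_ j lt) /gall_combine.
case; first by rewrite /base /one_gate /nL; lia.
by rewrite addn4 /= => -> -> -> -> ->.
Qed.

Lemma sat_block p l : (p < N)%N -> (l < nL)%N ->
  gv (base + 6 * nL * p.+2 + l)%N = v (nT + 2 + nL * p.+1 + l)%N /\
  gv (aval p (6 * nL, base + 13 * nL + 5 * l + 4)%N) =
    gv (posA l) * gv (base + 6 * nL * p.+2 + l)%N +
    gv (posB l) * gv (base + 6 * nL * p + l)%N +
    gv (posC l) * gv (base + 6 * nL * p.+1 + l)%N.
Proof.
move=> ltp ltl; move: gsat => /gall_cat [_].
have sb i : (i < N)%N -> size [seq rmap (aval i) g | g <- block] = (6 * nL)%N.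
  by rewrite size_map size_block.
move=> /(gall_blocks _ _ sb) /(_ p ltp).
rewrite map_block size_prologue add0n => /gall_cat [/gall_map s1].
move=> /gall_combines /(_ l ltl) /gall_combine.
case; first by rewrite size_map size_iota.
move=> /= e0 e1 e2 e3 e4; split.
  have := s1 l ltl; rewrite /= => e.
  have -> : (base + 6 * nL * p.+2 + l = base + 12 * nL + 6 * nL * p + l)%N.
    by rewrite !mulnS; lia.
  by rewrite e mulnS; congr v; lia.
have -> : aval p (6 * nL, base + 13 * nL + 5 * l + 4)%N =
          (base + 12 * nL + 6 * nL * p + nL + 5 * l).+4 by rewrite /aval /=; lia.
rewrite e4 /= e3 /= e0 e1 e2 /=.
by congr (_ * gv _ + _ + _ * gv _); rewrite !mulnS; lia.
Qed.

Lemma sat_cell p l : (p <= N)%N -> (l < nL)%N ->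
  gv (base + 6 * nL * p.+1 + l)%N = v (nT + 2 + nL * p + l)%N.
Proof.
case: p => [_ ltl|p lt ltl]; last by have [] := sat_block lt ltl.
by rewrite muln1 muln0 addn0; have [_ _ _ h _] := sat_prologue; apply: h.
Qed.

End Step.

Lemma nth_outs_obs N : nth 0%N (all_outs N) 0 = pos kObs. Proof. by []. Qed.
Lemma nth_outs_state N : nth 0%N (all_outs N) 1 = pos kState. Proof. by []. Qed.

Lemma nth_outs_head N j : (j < nT)%N ->
  nth 0%N (all_outs N) (j + 2) = (base + 7 * nL + 5 * j + 4)%N.
Proof.
move=> lt; rewrite addn2 /= nth_cat size_map size_iota lt.
by rewrite (nth_map 0%N) ?size_iota // nth_iota.
Qed.

Lemma nth_outs_cell N p l : (p < N)%N -> (l < nL)%N ->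
  nth 0%N (all_outs N) (nT + 2 + nL * p + l) =
  aval p (6 * nL, base + 13 * nL + 5 * l + 4)%N.
Proof.
move=> ltp ltl.
have sb i : (i < N)%N -> size [seq aval i x | x <- block_outs] = nL.
  by rewrite !size_map size_iota.
rewrite /all_outs nth_cat /= size_map size_iota.
have -> : (nT + 2 + nL * p + l < nT.+2)%N = false by lia.
have -> : (nT + 2 + nL * p + l - nT.+2 = nL * p + l)%N by lia.
rewrite nth_cat (size_blocks sb).
have -> : (nL * p + l < nL * N)%N.
  have : (nL * p + nL <= nL * N)%N by rewrite -mulnSr leq_mul2l ltp orbT.
  lia.
rewrite (nth_blocks _ sb) // (nth_map (0, 0)%N) ?size_map ?size_iota //.
by rewrite (nth_map 0%N) ?size_iota // nth_iota.
Qed.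

Lemma nth_outs_last N l : (l < nL)%N ->
  nth 0%N (all_outs N) (nT + 2 + nL * N + l) = pos kBlank.
Proof.
move=> ltl.
have sb i : (i < N)%N -> size [seq aval i x | x <- block_outs] = nL.
  by rewrite !size_map size_iota.
rewrite /all_outs nth_cat /= size_map size_iota.
have -> : (nT + 2 + nL * N + l < nT.+2)%N = false by lia.
have -> : (nT + 2 + nL * N + l - nT.+2 = nL * N + l)%N by lia.
rewrite nth_cat (size_blocks sb) ltnNge leq_addr /= addKn nth_nseq ltl //.
Qed.

Section OneStep.
Variables (o : St) (Rt Lt : tp -> nat -> symbol M).

Definition action := dstep o [ffun j => Rt j 0%N].
Definition written (j : tp) (p : nat) : symbol M :=
  if p is 0 then (action.2 j).1 else Rt j p.
Definition nextR (j : tp) (p : nat) : symbol M :=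
  match (action.2 j).2 with
  | MoveR => written j p.+1
  | Stay => written j p
  | MoveL => if p is p'.+1 then written j p' else Lt j 0%N
  end.
Definition nextL (j : tp) (p : nat) : symbol M :=
  match (action.2 j).2 with
  | MoveR => if p is p'.+1 then Lt j p' else written j 0
  | Stay => Lt j p
  | MoveL => Lt j p.+1
  end.

End OneStep.

(** The lanes differ by one: index 0 of [Rt] is the scanned cell, stored apart in [v (j + 2)], while
    index 0 of [Lt] is already the first cell of its lane. *)
Definition simulates (N : nat) (v : nat -> rat) (o : St)
    (Rt Lt : tp -> nat -> symbol M) : Prop :=
  [/\ v 1%N = cq o, forall j : tp, v (j + 2)%N = cs (Rt j 0%N)
    & forall p (j : tp), (p <= N)%N ->
        v (nT + 2 + nL * p + j)%N = cs (Rt j p.+1) /\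
        v (nT + 2 + nL * p + (nT + j))%N = cs (Lt j p)].

Lemma lane_tape_right (j : tp) : lane_tape j = j.
Proof. by apply: val_inj; rewrite /= inordK modn_small ?ltn_nT // nTE. Qed.

Lemma lane_tape_left (j : tp) : lane_tape (nT + j) = j.
Proof. by rewrite /lane_tape modnDl -/(lane_tape j) lane_tape_right. Qed.

(** The hypothesis on the outermost cells makes up for the constant blank that they receive; all the
    other cells are computed from their neighbours. *)
Lemma simulates_step N v gv o Rt Lt :
  sat v gv 0 (all_gates N) -> simulates N v o Rt Lt ->
  (forall j, nextR o Rt Lt j N.+1 = blank M /\ nextL o Rt Lt j N = blank M) ->
  simulates N (fun i => gv (nth 0%N (all_outs N) i))
    (action o Rt).1 (nextR o Rt Lt) (nextL o Rt Lt) /\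
  gv (nth 0%N (all_outs N) 0) = 1 - (accq o)%:R.
Proof.
move=> gsat [v1 vh vc] vb.
have [p1 p2 p3 p4 p5] := sat_prologue gsat.
have ctl k : gv (pos k) = ctl_val k o [ffun j => Rt j 0%N].
  apply: (ctl_sat p2) => [|j]; first by rewrite p1 ?v1 // addn2.
  by rewrite ffunE p1 ?vh // ltn_add2r ltn_nT.
have ltl (j : tp) : (j < nL)%N /\ (nT + j < nL)%N.
  by have := ltn_nT j; rewrite /nL; lia.
have cell0R (j : tp) : gv (base + 6 * nL * 0 + j)%N = cs (written o Rt j 0).
  by rewrite muln0 addn0 p3 ?(ltl j).1 // /posW lane_tape_right ctl.
have cell0L (j : tp) : gv (base + 6 * nL * 0 + (nT + j))%N = cs (written o Rt j 0).
  by rewrite muln0 addn0 p3 ?(ltl j).2 // /posW lane_tape_left ctl.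
have cellR p (j : tp) : (p <= N.+1)%N ->
    gv (base + 6 * nL * p + j)%N = cs (written o Rt j p).
  case: p => [|p] lt; first exact: cell0R.
  by rewrite (sat_cell gsat) ?(ltl j).1 // (vc _ _ _).1.
have cellL p (j : tp) : (p <= N)%N ->
    gv (base + 6 * nL * p.+1 + (nT + j))%N = cs (Lt j p).
  by move=> le; rewrite (sat_cell gsat) ?(ltl j).2 // (vc _ _ _).2.
have ltR (j : tp) : (j < nT)%N = true by apply: ltn_nT.
have ltL (j : tp) : (nT + j < nT)%N = false by lia.
split; last by rewrite nth_outs_obs ctl.
split.
- by rewrite nth_outs_state ctl.
- move=> j; rewrite nth_outs_head ?ltn_nT // p5 ?ltn_nT //.
  rewrite /posA /posB /posC ltR lane_tape_right !ctl.
  have := cellR 1%N j isT; rewrite muln1 => ->.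
  have := cellL 0%N j isT; rewrite muln1 addnA => ->.
  have := cell0R j; rewrite muln0 addn0 => ->.
  rewrite /= /nextR /written /action.
  by case: ((dstep _ _).2 j).2; rewrite !(mul0r, mul1r, add0r, addr0).
move=> p j; rewrite leq_eqVlt => /orP[/eqP->|lt].
  by rewrite !nth_outs_last ?(ltl j).1 ?(ltl j).2 // ctl (vb j).1 (vb j).2.
rewrite !nth_outs_cell ?(ltl j).1 ?(ltl j).2 //.
rewrite (sat_block gsat lt (ltl j).1).2 (sat_block gsat lt (ltl j).2).2.
rewrite !cellR ?cellL; [|lia..].
rewrite /posA /posB /posC ltR ltL lane_tape_left lane_tape_right.
rewrite !ctl /= /nextR /nextL /action.
(* The inner neighbour of the nearest left cell is the symbol just written under the head. *)
have -> : gv (base + 6 * nL * p + (nT + j))%N =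
    cs (if p is p'.+1 then Lt j p' else written o Rt j 0).
  by case: p lt => [|p] lt; [exact: cell0L | rewrite cellL //; lia].
by case: ((dstep _ _).2 j).2; rewrite !(mul0r, mul1r, add0r, addr0).
Qed.

(** * Initial values and the trajectory of a run *)

Section Run.
Variables (w : seq bool) (S : nat).
Hypothesis space_le : forall t, (space (run M w t) <= S)%N.

Notation N := (S + size w)%N.

Definition kpred : nat := (nT + 1 + nL * N.+1)%N.

Lemma kpredE : kpred.+1 = (nT + 2 + nL * N.+1)%N.
Proof. by rewrite /kpred addn2 addn1. Qed.

(** Lane 0 is the right lane of the first tape: a row holds one letter of the input and blanks in
    all the other lanes. *)
Definition init_row (a : symbol M) : seq rat :=
  cs a :: nseq nL.-1 (cs (blank M)).

(** In the extra state every head scans a blank, so the values before the rows do not depend on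
    [w]. *)
Definition init_list : seq rat :=
  [:: 1; cq None] ++ nseq nT (cs (blank M)) ++
  flatten [seq init_row (nth (blank M) (map (@bit M) w) p) | p <- iota 0 N.+1].

Lemma nL_gt0 : (0 < nL)%N. Proof. by rewrite /nL nTE. Qed.

Lemma size_init_row a : size (init_row a) = nL.
Proof. by rewrite /= size_nseq prednK // nL_gt0. Qed.

Lemma size_init_list : size init_list == kpred.+1.
Proof.
rewrite kpredE /init_list 2!size_cat size_nseq.
rewrite (@size_blocks _ (fun p => init_row (nth (blank M) (map (@bit M) w) p)) nL).
  by rewrite /= addnA addn2.
by move=> i _; apply: size_init_row.
Qed.

Lemma size_circuits :
  size [seq ccircuit kpred (all_gates N) o | o <- all_outs N] == kpred.+1.
Proof. by rewrite size_map size_all_outs kpredE. Qed.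

Definition instance : polyrec_input rat :=
  PolyrecInput (Tuple size_init_list) (Tuple size_circuits).

Definition ipoly (i : 'I_kpred.+1) : {mpoly rat[kpred.+1]} :=
  (cpolys kpred (all_gates N))`_(nth 0%N (all_outs N) i).

Definition iseq (n i : nat) : rat :=
  polyrec ipoly (tnth (init instance)) n (inord i).

Lemma inputs_kpred : inputs (all_gates N) = iota 0 kpred.+1.
Proof. by rewrite inputs_all_gates kpredE. Qed.

Lemma tnth_circuits (i : 'I_kpred.+1) :
  tnth (circuits instance) i = ccircuit kpred (all_gates N) (nth 0%N (all_outs N) i).
Proof.
rewrite (tnth_nth (ccircuit kpred (all_gates N) 0%N)); apply: nth_map.
by rewrite size_all_outs -kpredE.
Qed.

Lemma outs_lt (i : 'I_kpred.+1) :
  (nth 0%N (all_outs N) i < size (all_gates N))%N.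
Proof. by apply/all_outs_lt/mem_nth; rewrite size_all_outs -kpredE. Qed.

(** A circuit represents a single polynomial, so the family [P] chosen in [skolem] has to be
    [ipoly]. *)
Lemma skolem_instance : skolem instance <-> exists n, iseq n 0 = 0.
Proof.
have i0 : inord 0 = ord0 :> 'I_kpred.+1 by apply: val_inj; rewrite /= inordK.
split=> [[P rP [n e]]|[n e]].
  exists n; rewrite /iseq i0 -e.
  elim: n (ord0 : 'I_kpred.+1) {e} => //= n IH i.
  have := rP i; rewrite tnth_circuits => /represents_ccircuit ->.
  by apply: meval_eq => j; rewrite IH.
exists ipoly; last by exists n; rewrite -i0.
move=> i; rewrite tnth_circuits; apply: ccircuit_represents.
- exact: wf_all_gates.
- exact: inputs_kpred.
exact: outs_lt.
Qed.

(** Time is shifted by one, the first step being spent in the extra state. *)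
Definition traj_state (n : nat) : St :=
  if n is m.+1 then Some (cstate (run M w m)) else None.
Definition trajR (n : nat) (j : tp) (p : nat) : symbol M :=
  if n is m.+1 then nth (blank M) (tright (ctape (run M w m) j)) p
  else if j == ord0 then nth (blank M) (blank M :: map (@bit M) w) p else blank M.
Definition trajL (n : nat) (j : tp) (p : nat) : symbol M :=
  if n is m.+1 then nth (blank M) (tleft (ctape (run M w m) j)) p else blank M.

Lemma traj_step n :
  let o := traj_state n in let R := trajR n in let L := trajL n in
  [/\ (action o R).1 = traj_state n.+1,
      forall j p, nextR o R L j p = trajR n.+1 j p
    & forall j p, nextL o R L j p = trajL n.+1 j p].
Proof.
case: n => [|n] /=.
  split=> // j p; rewrite /nextR /nextL /written /action /= !ffunE.
    case: eqP => _ /=; first by case: p.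
    by rewrite /trajR nth_nil; case: p => //; case: eqP.
  by case: (j == ord0) => /=; case: p => //= p; rewrite nth_nil.
set c := run M w n; rewrite -/(step c).
have rd : [ffun j => nth (blank M) (tright (ctape c j)) 0] =
          [ffun j => tape_read (blank M) (ctape c j)].
  by apply/ffunP=> j; rewrite !ffunE nth0.
rewrite /nextR /nextL /written /action /dstep /step /trajR rd.
case: ifP => _ /=; split=> //= j p; rewrite ?ffunE /= ?nth0 //.
- by case: p.
- case: ((delta _ _).2 j) => a [] /=; rewrite ?nth_behead //;
    by case: p => [|[|p]] //=; rewrite nth_behead.
- case: ((delta _ _).2 j) => a [] /=; rewrite ?nth_behead //; by case: p.
Qed.

Lemma simulates_eq v v' o Rt Rt' Lt Lt' :
  (forall i, (i < kpred.+1)%N -> v i = v' i) ->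
  (forall j p, Rt j p = Rt' j p) -> (forall j p, Lt j p = Lt' j p) ->
  simulates N v o Rt Lt -> simulates N v' o Rt' Lt'.
Proof.
move=> ev eR eL [h1 h2 h3]; rewrite kpredE in ev.
have kN p : (p <= N)%N -> (nL * p + nL <= nL * N.+1)%N.
  by move=> le; rewrite -mulnSr leq_mul2l ltnS le orbT.
split=> [|j|p j le].
- by rewrite -ev ?h1 // addn2.
- by rewrite -ev ?h2 ?eR //; have := ltn_nT j; lia.
have := kN p le; have := ltn_nT j; have := erefl nL; rewrite {2}/nL => *.
by rewrite -eR -eL -!ev; [exact: h3 | lia..].
Qed.

Lemma iseqS n i : (i < kpred.+1)%N -> iseq n.+1 i =
  ((cpolys kpred (all_gates N))`_(nth 0%N (all_outs N) i)).@[
    polyrec ipoly (tnth (init instance)) n].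
Proof. by move=> lt; rewrite /iseq /= /ipoly inordK. Qed.

Lemma iseq0 i : (i < kpred.+1)%N -> iseq 0 i = nth 0 init_list i.
Proof. by move=> lt; rewrite /iseq /= (tnth_nth 0) /= inordK. Qed.

Lemma simulates_traj n : simulates N (iseq n) (traj_state n) (trajR n) (trajL n) /\
  iseq n.+1 0 = 1 - (accq (traj_state n))%:R.
Proof.
have kgt1 : (1 < kpred.+1)%N by rewrite kpredE addn2.
have step m : simulates N (iseq m) (traj_state m) (trajR m) (trajL m) ->
    simulates N (iseq m.+1) (traj_state m.+1) (trajR m.+1) (trajL m.+1) /\
    iseq m.+1 0 = 1 - (accq (traj_state m))%:R.
  have [e1 e2 e3] := traj_step m => /(simulates_step (sat_cpolys _ (@wf_all_gates N))).
  case.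
    move=> j; rewrite e2 e3 /trajR /trajL.
    (* Each tape lists at most [S] cells and [S <= N], so the indices [N] and [N.+1] fall beyond the
       lists, on the default blank. *)
    have le := space_le m; rewrite /space (bigD1 j) //= /tape_cells in le.
    by split; apply: nth_default; lia.
  rewrite e1 => h1 h2; split; last by rewrite iseqS.
  by apply: simulates_eq h1 => // i lt; rewrite iseqS.
suff h m : simulates N (iseq m) (traj_state m) (trajR m) (trajL m).
  by split=> //; have [] := step n (h n).
elim: m => [|m /step [] //].
have rowE p l : (p <= N)%N -> (l < nL)%N -> (nT + 2 + nL * p + l < kpred.+1)%N /\
    nth 0 init_list (nT + 2 + nL * p + l) =
    nth 0 (init_row (nth (blank M) (map (@bit M) w) p)) l.
  move=> lep ltl; split.
    rewrite kpredE; have : (nL * p + nL <= nL * N.+1)%N by rewrite -mulnSr leq_mul2l ltnS lep orbT.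
    by lia.
  rewrite /init_list nth_cat.
  have -> : (nT + 2 + nL * p + l < size [:: 1%R; cq None] = false)%N by rewrite /=; lia.
  rewrite nth_cat size_nseq.
  have -> : (nT + 2 + nL * p + l - size [:: 1%R; cq None] < nT = false)%N by rewrite /=; lia.
  have -> : (nT + 2 + nL * p + l - size [:: 1%R; cq None] - nT = nL * p + l)%N by rewrite /=; lia.
  by rewrite (nth_blocks _ (fun i _ => size_init_row _)).
split=> [|j|p j lep].
- by rewrite iseq0.
- have ltj := ltn_nT j; rewrite iseq0 ?kpredE; last lia.
  rewrite addn2 /= nth_cat size_nseq ltj nth_nseq ltj.
  by case: eqP.
have [ltj1 ltj2] : (j < nL)%N /\ (nT + j < nL)%N by have := ltn_nT j; rewrite /nL; lia.
have [lt1 e1] := rowE p j lep ltj1; have [lt2 e2] := rowE p (nT + j)%N lep ltj2.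
rewrite !iseq0 // e1 e2 /trajR /trajL; split.
  rewrite /init_row; case: (eqVneq j ord0) => [->|j0] //.
  have jp : (0 < j)%N by rewrite lt0n.
  by rewrite -{1}(prednK jp) /= nth_nseq; case: ifP => //; lia.
rewrite /init_row nTE addSn /= nth_nseq; case: ifP => //.
by rewrite nTE in ltj2; lia.
Qed.

Lemma skolem_instance_accepts :
  skolem instance <-> exists t, halting (cstate (run M w t)) && accepting (cstate (run M w t)).
Proof.
rewrite skolem_instance; split=> [[[|n]]|[t acc]].
- by rewrite iseq0.
- have [_ ->] := simulates_traj n; case: n => [|n] /=; first by rewrite subr0.
  by move=> h; exists n; case: andP h => //= _; rewrite subr0.
(* One step for the extra state, one for the delay of the observed variable. *)
by exists t.+2; have [_ ->] := simulates_traj t.+1; rewrite /= acc subrr.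
Qed.

End Run.

(** * Printing the instance *)

Section Encoding.
Local Open Scope nat_scope.
Variables c d : nat.

Notation X := 'I_(d + 5).+1.
Implicit Types (y : X) (e : {ffun X -> nat}).

Definition encs (A : Type) (f : A -> seq bool) (s : seq A) : seq bool :=
  flatten [seq true :: f x | x <- s].

Lemma enc_seqE (A : Type) (f : A -> seq bool) s : enc_seq f s = encs f s ++ [:: false].
Proof. by []. Qed.

Lemma encs_cat (A : Type) (f : A -> seq bool) s t : encs f (s ++ t) = encs f s ++ encs f t.
Proof. by rewrite /encs map_cat flatten_cat. Qed.

Lemma encs_flatten (A : Type) (f : A -> seq bool) ss :
  encs f (flatten ss) = flatten (map (encs f) ss).
Proof. by elim: ss => //= s ss IH; rewrite encs_cat IH. Qed.

Definition enc_rgate (g : rgate nat) : seq bool :=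
  match g with
  | RInput i => [:: false; false] ++ enc_unary i
  | RConst q => [:: false; true] ++ enc_rat q
  | RAdd a b => [:: true; false] ++ enc_unary a ++ enc_unary b
  | RMul a b => [:: true; true] ++ enc_unary a ++ enc_unary b
  end.

Lemma encs_cook k gs : all (fun i => i < k.+1) (inputs gs) ->
  encs (@enc_gate k.+1) (map (@cook k) gs) = encs enc_rgate gs.
Proof.
rewrite /encs; elim: gs => //= -[i|q|a b|a b] gs IH /=; try by move/IH->.
by case/andP=> lt /IH ->; rewrite inordK.
Qed.

Definition gseq (gs : seq (gen X)) : gen X := foldr (@GCat X) (GEmit X [::]) gs.

Lemma geval_gseq e gs : geval e (gseq gs) = flatten (map (geval e) gs).
Proof. by elim: gs => //= g gs ->. Qed.

(** The coefficient is a constant of the program, so the multiple of the counter is printed by that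
    many copies of [GPow]. *)
Definition gaff y (x : aff) : gen X :=
  GCat (gseq (nseq x.1 (GPow y))) (GEmit X (nseq x.2 true ++ [:: false])).

Lemma geval_gaff e y x : geval e (gaff y x) = enc_unary (aval (e y) x).
Proof.
rewrite /= geval_gseq map_nseq /= catA /enc_unary /aval; congr (_ ++ _).
rewrite nseqD; congr (_ ++ _).
by elim: x.1 => //= n ->; rewrite -nseqD mulSn.
Qed.

Definition grgate y (g : rgate aff) : gen X :=
  match g with
  | RInput x => GCat (GEmit X [:: true; false; false]) (gaff y x)
  | RConst q => GEmit X ([:: true; false; true] ++ enc_rat q)
  | RAdd a b => GCat (GEmit X [:: true; true; false]) (GCat (gaff y a) (gaff y b))
  | RMul a b => GCat (GEmit X [:: true; true; true]) (GCat (gaff y a) (gaff y b))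
  end.

Lemma geval_grgate e y g :
  geval e (grgate y g) = true :: enc_rgate (rmap (aval (e y)) g).
Proof. by case: g => [x|q|a b|a b] //; rewrite /rmap /enc_rgate -!(geval_gaff e y). Qed.

Notation vS := (vS d).
Notation vN := (vN d).

Definition ggates y : gen X :=
  GCat (GEmit X (encs enc_rgate prologue))
       (GFor vN y (gseq [seq grgate y g | g <- block])).

Lemma geval_ggates e y : geval e (ggates y) = encs enc_rgate (all_gates (e vN)).
Proof.
rewrite /= /all_gates encs_cat encs_flatten -map_comp; congr (_ ++ flatten _).
apply: eq_map => i; rewrite geval_gseq /= /encs -!map_comp; congr flatten.
by apply: eq_map => g; rewrite /= geval_grgate upd_eq.
Qed.

Definition enc_out (N o : nat) : seq bool :=
  true :: encs enc_rgate (all_gates N) ++ [:: false; true] ++ enc_unary o ++ [:: false].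

Definition gout_const (o : nat) : gen X :=
  GCat (GEmit X [:: true]) (GCat (ggates (ly d 0))
    (GEmit X ([:: false; true] ++ enc_unary o ++ [:: false]))).

(** Here [ly d 0] already counts the blocks of outputs, so the gate list needs a second counter. *)
Definition gout_aff (x : aff) : gen X :=
  GCat (GEmit X [:: true]) (GCat (ggates (ly d 1))
    (GCat (GEmit X [:: false; true]) (GCat (gaff (ly d 0) x) (GEmit X [:: false])))).

Lemma geval_gout_const e o : geval e (gout_const o) = enc_out (e vN) o.
Proof. by rewrite /gout_const /enc_out -(geval_ggates e (ly d 0)). Qed.

Lemma geval_gout_aff e x : geval e (gout_aff x) = enc_out (e vN) (aval (e (ly d 0)) x).
Proof. by rewrite /gout_aff /enc_out -(geval_ggates e (ly d 1)) -geval_gaff. Qed.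

Definition gouts : gen X :=
  GCat (gseq (map gout_const head_outs))
  (GCat (GFor vN (ly d 0) (gseq (map gout_aff block_outs)))
        (gseq (map gout_const (nseq nL (pos kBlank))))).

Lemma geval_gouts e : geval e gouts = flatten (map (enc_out (e vN)) (all_outs (e vN))).
Proof.
have yN : vN != ly d 0 by apply: neq_val; rewrite val_vN val_ly ?addn2.
have constE s : geval e (gseq (map gout_const s)) = flatten (map (enc_out (e vN)) s).
  by rewrite geval_gseq -map_comp; congr flatten; apply: eq_map => o; apply: geval_gout_const.
have flat2 T (ss : seq (seq (seq T))) : flatten (flatten ss) = flatten (map flatten ss).
  by elim: ss => //= s ss IH; rewrite flatten_cat IH.
have loopE : geval e (GFor vN (ly d 0) (gseq (map gout_aff block_outs))) =
    flatten (map (enc_out (e vN))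
      (flatten [seq [seq aval i x | x <- block_outs] | i <- iota 0 (e vN)])).
  rewrite map_flatten flat2 -!map_comp; congr flatten.
  apply: eq_map => i; rewrite -/(geval _ _) geval_gseq /= -!map_comp; congr flatten.
  by apply: eq_map => x; apply: etrans (geval_gout_aff _ _) _; rewrite upd_eq upd_neq.
rewrite /all_outs (map_cat _ head_outs) (map_cat _ (flatten _)) !flatten_cat.
by rewrite -(constE head_outs) -(constE (nseq _ _)) -loopE.
Qed.

Definition enc_row (a : symbol M) : seq bool := encs enc_rat (init_row a).

Definition gmain : gen X :=
  GCat (GFor vS (ly d 0) (GEmit X (enc_row (blank M))))
  (GCat (GEmit X (enc_row (blank M) ++ [:: false]))
  (GCat gouts (GEmit X [:: false]))).

Definition header : seq bool :=
  encs enc_rat ([:: 1; cq None] ++ nseq nT (cs (blank M)))%R.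

Lemma gwf_gmain : gwf [pred x : X | x <= 2] (@loops d) [::] gmain.
Proof.
have y01 : ly d 1 != ly d 0 by apply: neq_val; rewrite !val_ly ?addn2.
have l0 : loops (ly d 0) by rewrite /loops val_ly ?addn2 //; lia.
have l1 : loops (ly d 1) by rewrite /loops val_ly ?addn2 //; lia.
pose wf := gwf [pred x : X | x <= 2] (@loops d).
have seqwf A bs (f : A -> gen X) s : (forall x, wf bs (f x)) -> wf bs (gseq (map f s)).
  by move=> h; elim: s => //= x s IH; apply/andP; split; first exact: h.
have affwf bs y x : y \in bs -> wf bs (gaff y x).
  move=> yb; apply/andP; split=> //; rewrite -(map_nseq _ (fun=> GPow y) tt).
  exact: seqwf.
have gatewf bs y g : y \in bs -> wf bs (grgate y g).
  move=> yb; have h x := affwf bs y x yb.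
  by case: g => [x|q|a b|a b] //; [exact: (h x) | apply/and3P; split=> //; apply: h..].
have gateswf bs y : loops y -> y \notin bs -> wf bs (ggates y).
  move=> ly yb; apply/andP; split=> //; apply/and4P; split=> //.
    by rewrite /= val_vN.
  by apply: seqwf => g; apply/gatewf/mem_head.
have constwf s : wf [::] (gseq (map gout_const s)).
  apply: seqwf => o; apply/and3P; split=> //; exact: gateswf.
have affswf : wf [:: ly d 0] (gseq (map gout_aff block_outs)).
  apply: seqwf => x; apply/and3P; split=> //.
    by apply: gateswf; rewrite ?inE.
  by apply/and3P; split=> //; apply/affwf/mem_head.
have catwf bs g h : wf bs g -> wf bs h -> wf bs (GCat g h).
  by move=> hg hh; apply/andP.
have forwf (x : X) g : x <= 2 -> wf [:: ly d 0] g -> wf [::] (GFor x (ly d 0) g).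
  by move=> hx hg; apply/and4P.
rewrite -/(wf [::] gmain) /gmain; apply: (catwf); first by apply: forwf; rewrite // val_vS.
do 2![apply: (catwf) => //]; rewrite /gouts; do 2![apply: (catwf) => //].
by apply: forwf affswf; rewrite val_vN.
Qed.

Lemma encode_instance w (S := pbound c d (size w)) :
  encode (instance w S) =
  gfun c header (enc_row (bit M false)) (enc_row (bit M true)) gmain w.
Proof.
set N := (S + size w)%N.
have eS : genv c d (size w) vS = S.
  by rewrite ffunE -!val_eqE /= val_vS.
have eN : genv c d (size w) vN = N.
  by rewrite ffunE -!val_eqE /= val_vN val_vS.
have -> : encode (instance w S) = (encs enc_rat (init_list w S) ++ [:: false]) ++
    (encs (@enc_circuit _) [seq ccircuit (kpred w S) (all_gates N) o | o <- all_outs N] ++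
     [:: false]) by [].
have -> : encs (@enc_circuit _) [seq ccircuit (kpred w S) (all_gates N) o | o <- all_outs N]
    = flatten (map (enc_out N) (all_outs N)).
  rewrite /encs -map_comp; congr flatten; apply: eq_map => o.
  change (true :: (enc_seq (@enc_gate _) (map (@cook (kpred w S)) (all_gates N)) ++
    enc_seq enc_unary [:: o]) = enc_out N o); rewrite !enc_seqE encs_cook.
    by rewrite /enc_out /encs /= cats0 -!catA.
  by rewrite inputs_kpred; apply/allP=> i; rewrite mem_iota.
have -> : encs enc_rat (init_list w S) = header ++
    (flatten [seq if b then enc_row (bit M true) else enc_row (bit M false) | b <- w] ++
     (flatten (nseq S (enc_row (blank M))) ++ enc_row (blank M))).
  rewrite /init_list (catA _ (nseq _ _)) encs_cat -/header. congr (_ ++ _).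
  rewrite (encs_flatten enc_rat) -map_comp.
  pose row p := enc_row (nth (blank M) (map (@bit M) w) p).
  rewrite -[RHS]/(_ ++ (_ ++ _)).
  have blank_row p : size w <= p -> row p = enc_row (blank M).
    by move=> le; rewrite /row nth_default // size_map.
  (* This splitting motivates [N = S + size w]: the rows of the letters, then [S] blank rows printed
     by a loop over [vS], then one last blank row. *)
  have -> : (S + size w).+1 = size w + (S + 1) by lia.
  rewrite iotaD iotaD add0n map_cat map_cat !flatten_cat; congr (_ ++ (_ ++ _)).
  - rewrite (_ : map _ _ = [seq enc_row a | a <- map (@bit M) w]).
      by rewrite -map_comp; congr flatten; apply: eq_map => -[].
    rewrite -[in RHS](take_size (map _ w)) size_map -(map_nth_iota0 (blank M)) ?size_map //.
    by rewrite -map_comp.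
  - congr flatten; have := leqnn (size w); move: {2 3}(size w) => b.
    elim: (S) b => //= n IH b le; rewrite IH; last exact: leqW.
    by rewrite -(blank_row b).
  by rewrite /= cats0; apply: blank_row; lia.
have gE : geval (genv c d (size w)) gmain =
    flatten (nseq S (enc_row (blank M))) ++
    ((enc_row (blank M) ++ [:: false]) ++
     (flatten (map (enc_out N) (all_outs N)) ++ [:: false])).
  rewrite -eN -geval_gouts -{1}eS; congr (_ ++ _).
  rewrite -[LHS]/(flatten [seq enc_row (blank M) | i <- iota 0 (genv c d (size w) vS)]).
  have cst (r : seq bool) n b : [seq r | i <- iota b n] = nseq n r.
    by elim: n b => //= n IH b; rewrite IH.
  by rewrite cst.
by rewrite /gfun gE -!catA.
Qed.

End Encoding.

End Simulation.

(** * The reduction *)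

Lemma run_halted (M : machine) w t t' :
  t <= t' -> halting (cstate (run M w t)) -> run M w t' = run M w t.
Proof.
move=> /subnKC <- h; elim: (t' - t) => [|n IH]; first by rewrite addn0.
by rewrite addnS /run iterS -/(run M w _) IH /step h.
Qed.

Lemma accepts_halting (M : machine) w t :
  halting (cstate (run M w t)) ->
  (exists t', halting (cstate (run M w t')) && accepting (cstate (run M w t'))) <->
  accepting (cstate (run M w t)).
Proof.
move=> ht; split=> [[t' /andP[ht' at']]|acc]; last by exists t; rewrite ht.
have [le|/ltnW le] := leqP t t'; first by rewrite -(run_halted le).
by rewrite (run_halted le).
Qed.

Theorem corollary25 : PSPACE_hard skolem_rat.
Proof.
move=> L [M [c [d hM]]].
have [gs [pos [ctl_wf ctl_in pos_lt ctl_sat]]] := control_exists M.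
pose f := gfun c (header M) (enc_row (bit M false)) (enc_row (bit M true)) (gmain gs pos d).
exists f; split; first exact: polytime_gfun (gwf_gmain gs pos d).
move=> w; have [space_le [t [ht Lt]]] := hM w.
rewrite Lt -(accepts_halting ht).
rewrite -(skolem_instance_accepts ctl_wf ctl_in pos_lt ctl_sat space_le).
(* Injectivity of [encode] is what the converse needs: the only input encoded by the printed word is
   [instance]. *)
rewrite /f -encode_instance //; split=> [h|[I /encode_inj <-]] //.
by exists (instance gs pos w (pbound c d (size w))).
Qed.
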